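(* Let $\mathcal{H}$ be a separable Hilbert space, $0<\alpha\leq\beta$, and let $A\colon\operatorname{dom}(A)\subseteq\mathcal{H}\to\mathcal{H}$ be skew-selfadjoint. Assume that the embedding $\operatorname{dom}(A)\cap\ker(A)^\perp\hookrightarrow\mathcal{H}$ is compact (where $\operatorname{dom}(A)\cap\ker(A)^\perp$ carries the graph norm of $A$). Let $(T_n)_{n\in\mathbb{N}}$ be a sequence in $\mathcal{F}(\alpha,\beta;\mathcal{H})$. Then the following conditions are equivalent: (i) There exists $T\in\mathcal{M}(\ker(A),\operatorname{ran}(A))$ such that $T_n\to T$ in $\tau(\ker(A),\operatorname{ran}(A))$ as $n\to\infty$. (ii) There exists $S\in\mathcal{L}_{\mathrm b}(\mathcal{H})$ such that $(T_n+A)^{-1}\to S$ in the weak operator topology as $n\to\infty$. In either case, $T\in\mathcal{F}(\alpha,\beta;\mathcal{H})$ and $S=(T+A)^{-1}$.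
   Context: $\mathcal{L}_{\mathrm b}$ denotes bounded linear operators. A densely defined operator $A$ is skew-selfadjoint if $A=-A^*$. Under the compactness assumption $\operatorname{ran}(A)$ is closed, so $\operatorname{ran}(A)=\ker(A)^\perp$. For $0<\alpha\leq\beta$: $\mathcal{F}(\alpha,\beta;\mathcal{H})=\{T\in\mathcal{L}_{\mathrm b}(\mathcal{H}):\operatorname{Re}T\geq\alpha,\ \operatorname{Re}T^{-1}\geq1/\beta\}$, where $\operatorname{Re}T=(T+T^* )/2$ and $\operatorname{Re}T\geq c$ means $\operatorname{Re}\langle\phi,T\phi\rangle\geq c\|\phi\|^2$ for all $\phi$. (For $T\in\mathcal{F}(\alpha,\beta;\mathcal{H})$ the operator $T+A$ with domain $\operatorname{dom}(A)$ is continuously invertible.) Schur topology: let $\mathcal{H}_0\subseteq\mathcal{H}$ be a closed subspace, $\mathcal{H}_1=\mathcal{H}_0^\perp$, $\iota_j\colon\mathcal{H}_j\hookrightarrow\mathcal{H}$ the embeddings, and $a_{jk}=\iota_j^*a\iota_k$ for $a\in\mathcal{L}_{\mathrm b}(\mathcal{H})$. Let $\mathcal{M}(\mathcal{H}_0,\mathcal{H}_1)$ be the set of $a\in\mathcal{L}_{\mathrm b}(\mathcal{H})$ such that $a$ and $a_{00}$ are continuously invertible. $\tau(\mathcal{H}_0,\mathcal{H}_1)$ is the initial topology on $\mathcal{M}(\mathcal{H}_0,\mathcal{H}_1)$ with respect to the maps $a\mapsto a_{00}^{-1}\in\mathcal{L}_{\mathrm b}(\mathcal{H}_0)$, $a\mapsto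 a_{00}^{-1}a_{01}\in\mathcal{L}_{\mathrm b}(\mathcal{H}_1,\mathcal{H}_0)$, $a\mapsto a_{10}a_{00}^{-1}\in\mathcal{L}_{\mathrm b}(\mathcal{H}_0,\mathcal{H}_1)$, $a\mapsto a_{11}-a_{10}a_{00}^{-1}a_{01}\in\mathcal{L}_{\mathrm b}(\mathcal{H}_1)$, where all target spaces carry the weak operator topology. *)

(* Defs.v *)
From HB Require Import structures.
From mathcomp Require Import all_boot all_order all_algebra.
From mathcomp Require Import all_classical all_reals topology normedtype.
From mathcomp Require Import complex.

Set Implicit Arguments.
Unset Strict Implicit.
Unset Printing Implicit Defensive.

Import Order.TTheory GRing.Theory Num.Theory.
Import numFieldNormedType.Exports.

Local Open Scope classical_set_scope.
Local Open Scope ring_scope.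
Local Open Scope complex_scope.

(* Hilbert spaces are complex; the scalar field is [R[i]] for [R : realType].
   The inner product [inner x y] is linear in [x] and antilinear in [y]. *)
HB.mixin Record NormedModule_isPreHilbert (R : realType) U
    & NormedModule R[i] U := {
  inner : {dot U for (@Num.conj R[i])};
  sqr_norm_inner : forall x : U, `|x| ^+ 2 = inner x x
}.

#[short(type="preHilbertType")]
HB.structure Definition PreHilbert (R : realType) :=
  {U of NormedModule_isPreHilbert R U & NormedModule R[i] U}.

#[short(type="hilbertType")]
HB.structure Definition Hilbert (R : realType) :=
  {U of PreHilbert R U & Complete U}.

Definition separable (T : topologicalType) : Prop :=
  exists D : set T, countable D /\ dense D.

Section Subspaces.
Context {R : realType} {H : preHilbertType R}.

(* Linear subspaces, not necessarily closed. *)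
Record subspace := Subspace {
  subspace_set :> set H;
  subspace0 : subspace_set 0;
  subspaceP : forall (a : R[i]) (x y : H),
    subspace_set x -> subspace_set y -> subspace_set (a *: x + y)
}.

Definition orthogonal (W : set H) : set H :=
  [set x | forall y, W y -> inner x y = 0].

Definition subspace_pred (W : subspace) : {pred H} :=
  fun x => `[< subspace_set W x >].

Lemma subspace_pred_closed (W : subspace) : submod_closed (subspace_pred W).
Proof.
split; first by apply/asboolP; exact: subspace0.
by move=> a x y /asboolP Wx /asboolP Wy; apply/asboolP; exact: subspaceP.
Qed.

HB.instance Definition _ (W : subspace) :=
  GRing.isSubmodClosed.Build R[i] H (subspace_pred W) (subspace_pred_closed W).

Record elt (W : subspace) := Elt {
  emb : H;
  eltP : emb \in subspace_pred W
}.

End Subspaces.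
Arguments subspace {R} H.

Section SubspaceStructure.
Context {R : realType} {H : preHilbertType R} (W : subspace H).

HB.instance Definition _ := [isSub for @emb R H W].
HB.instance Definition _ := [Choice of elt W by <:].
HB.instance Definition _ := [SubChoice_isSubLmodule of elt W by <:].

Let norm (x : elt W) : R[i] := `|emb x|.

Let normD x y : norm (x + y) <= norm x + norm y.
Proof. exact: ler_normD. Qed.

Let normZ l x : norm (l *: x) = `|l| * norm x.
Proof. exact: normrZ. Qed.

Let norm_eq0 x : norm x = 0 -> x = 0.
Proof. by move=> /normr0_eq0 x0; apply: val_inj. Qed.

HB.instance Definition _ :=
  @Lmodule_isNormed.Build R[i] (elt W) norm normD normZ norm_eq0.


Let dot (x y : elt W) : R[i] := inner (emb x) (emb y).

Let dot_bilinear : bilinear_for *%R (@Num.conj R[i] \; *%R) dot.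
Proof.
by split=> [x a y z|x a y z]; rewrite /dot /= (linearPl, linearPr).
Qed.

HB.instance Definition _ := bilinear_isBilinear.Build R[i] (elt W) (elt W) R[i]
  *%R (@Num.conj R[i] \; *%R) dot dot_bilinear.

Let dot_hermitian x y : dot x y = (-1) ^+ false * (dot y x)^*.
Proof. exact: hermitian_subproof. Qed.

HB.instance Definition _ := isHermitianSesquilinear.Build R[i] (elt W)
  false (@Num.conj R[i]) dot dot_hermitian.

Let dot_gt0 x : x != 0 -> 0 < dot x x.
Proof. by move=> x0; apply: neq0_dnorm_gt0. Qed.

HB.instance Definition _ := isDotProduct.Build R[i] (elt W) dot dot_gt0.

Let sqr_norm_dot x : `|x| ^+ 2 = dot x x.
Proof. exact: sqr_norm_inner. Qed.

HB.instance Definition _ := NormedModule_isPreHilbert.Build R (elt W)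
  sqr_norm_dot.

End SubspaceStructure.

Definition bounded_linear_pred (R : realType) (U V : preHilbertType R) :
    {pred U -> V} :=
  fun f => `[< linear f /\ exists M : R[i], forall x, `|f x| <= M * `|x| >].
Arguments bounded_linear_pred {R} U V.

Record bop (R : realType) (U V : preHilbertType R) := Bop {
  bop_fun :> U -> V;
  bopP : bop_fun \in bounded_linear_pred U V
}.

Notation "''Lb' ( U , V )" := (bop U V)
  (at level 8, format "''Lb' ( U ,  V )") : type_scope.

Section BopStructure.
Context {R : realType} (U V : preHilbertType R).

Lemma bounded_linear_closed : submod_closed (bounded_linear_pred U V).
Proof.
split.
  apply/asboolP; split; first by move=> a x y; rewrite /= scaler0 addr0.
  by exists 0 => x; rewrite normr0 mul0r.
move=> a f g /asboolP[lf [M fM]] /asboolP[lg [N gN]]; apply/asboolP; split.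
  move=> b x y; rewrite !fctE lf lg !scalerDr !scalerA (mulrC b).
  by rewrite addrACA.
exists (`|a| * M + N) => x; rewrite !fctE.
rewrite (le_trans (ler_normD _ _))// mulrDl lerD// normrZ -mulrA.
by rewrite ler_wpM2l.
Qed.

HB.instance Definition _ := GRing.isSubmodClosed.Build R[i] (U -> V)
  (bounded_linear_pred U V) bounded_linear_closed.
HB.instance Definition _ := [isSub for @bop_fun R U V].
HB.instance Definition _ := [Choice of 'Lb(U, V) by <:].
HB.instance Definition _ := [SubChoice_isSubLmodule of 'Lb(U, V) by <:].

Lemma bop_linear (a : 'Lb(U, V)) : linear a.
Proof. by have /asboolP[] := bopP a. Qed.

Lemma bop_bounded (a : 'Lb(U, V)) :
  exists M : R[i], forall x, `|a x| <= M * `|x|.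
Proof. by have /asboolP[] := bopP a. Qed.

HB.instance Definition _ (a : 'Lb(U, V)) :=
  GRing.isLinear.Build R[i] U V *:%R a (bop_linear a).

End BopStructure.

Section BopOperations.
Context {R : realType}.
Implicit Types U V W : preHilbertType R.

Lemma bop_comp_subproof U V W (a : 'Lb(V, W)) (b : 'Lb(U, V)) :
  a \o b \in bounded_linear_pred U W.
Proof.
apply/asboolP; split; first by move=> k x y /=; rewrite !linearP.
have [M aM] := bop_bounded a; have [N bN] := bop_bounded b.
exists (`|M| * `|N|) => x /=.
have le_abs (K : R[i]) (s t : R[i]) : 0 <= s -> 0 <= t -> t <= K * s ->
    t <= `|K| * s.
  by move=> s0 t0 /[dup] tKs /(le_trans t0) Ks0;
    rewrite (le_trans tKs)// -(ger0_norm Ks0) normrM (ger0_norm s0).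
rewrite -mulrA (le_trans (le_abs _ _ _ _ _ (aM (b x))))//.
by rewrite ler_wpM2l// le_abs.
Qed.

Definition bop_comp U V W (a : 'Lb(V, W)) (b : 'Lb(U, V)) : 'Lb(U, W) :=
  Bop (bop_comp_subproof a b).

Lemma emb_bounded_linear (H : preHilbertType R) (W : subspace H) :
  (@emb R H W) \in bounded_linear_pred (elt W) H.
Proof. by apply/asboolP; split => //; exists 1 => x; rewrite mul1r. Qed.

Definition bemb (H : preHilbertType R) (W : subspace H) : 'Lb(elt W, H) :=
  Bop (emb_bounded_linear W).

(* The adjoint and the inverse are chosen by description; the value is [0] when
   none exists (existence of the adjoint is the Riesz representation theorem
   when [U] is complete). *)
Definition is_adjoint U V (a : 'Lb(U, V)) (b : 'Lb(V, U)) : Prop :=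
  forall x y, inner (a x) y = inner x (b y).

Definition adjoint U V (a : 'Lb(U, V)) : 'Lb(V, U) :=
  xget 0 [set b | is_adjoint a b].

Definition is_inverse U V (a : 'Lb(U, V)) (b : 'Lb(V, U)) : Prop :=
  cancel a b /\ cancel b a.

Definition invertible U V (a : 'Lb(U, V)) : Prop := exists b, is_inverse a b.

Definition bop_inv U V (a : 'Lb(U, V)) : 'Lb(V, U) :=
  xget 0 [set b | is_inverse a b].

Definition re_ge U (a : 'Lb(U, U)) (c : R) : Prop :=
  forall x, c%:C * `|x| ^+ 2 <= 'Re (inner x (a x)).

Definition classF (alpha beta : R) (U : preHilbertType R) : set 'Lb(U, U) :=
  [set a | re_ge a alpha /\ invertible a /\ re_ge (bop_inv a) beta^-1].

Lemma adjointE U V (a : 'Lb(U, V)) (b : 'Lb(V, U)) :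
  is_adjoint a b -> adjoint a = b.
Proof.
move=> ab; rewrite /adjoint; case: xgetP => [c _ ac|/(_ b)/(_ ab)//].
apply/val_inj/funext => y /=; apply/eqP; rewrite -subr_eq0 -normr_eq0.
have cb x : inner x (c y) = inner x (b y) by rewrite -ab -ac.
by rewrite -sqrf_eq0 sqr_norm_inner linearBr /= cb subrr.
Qed.

Lemma bop_invE U V (a : 'Lb(U, V)) (b : 'Lb(V, U)) :
  is_inverse a b -> bop_inv a = b.
Proof.
move=> ab; rewrite /bop_inv; case: xgetP => [c _ [ac _]|/(_ b)/(_ ab)//].
by apply/val_inj/funext => y /=; rewrite -{1}(ab.2 y) ac.
Qed.

(* The weak operator topology is the initial topology for the family of all
   [a |-> <a x, y>]. *)
Definition wot U V : topologicalType := @initial_topology 'Lb(U, V)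
  {ptws U * V -> R[i]^o} (fun a p => inner (a p.1) p.2).

End BopOperations.

Section SchurTopology.
Context {R : realType} {H : preHilbertType R}.
Implicit Types W : subspace H.

(* [block Wj Wk a] is [a_jk], an operator from [Wk] to [Wj]. *)
Definition block Wj Wk (a : 'Lb(H, H)) : 'Lb(elt Wk, elt Wj) :=
  bop_comp (adjoint (bemb Wj)) (bop_comp a (bemb Wk)).

Definition schur_domain W0 W1 : set 'Lb(H, H) :=
  [set a | invertible a /\ invertible (block W0 W0 a)].

Definition schur_map W0 W1 (a : schur_domain W0 W1) :
    wot (elt W0) (elt W0) * wot (elt W1) (elt W0) *
    wot (elt W0) (elt W1) * wot (elt W1) (elt W1) :=
  let a00V := bop_inv (block W0 W0 (\val a)) in
  let a01 := block W0 W1 (\val a) in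
  let a10 := block W1 W0 (\val a) in
  let a11 := block W1 W1 (\val a) in
  (a00V, bop_comp a00V a01, bop_comp a10 a00V,
   a11 - bop_comp a10 (bop_comp a00V a01)).

(* The formulas are stated for any two subspaces; the topology is meant for [W0]
   closed and [W1] its orthogonal complement, when [adjoint (bemb Wj)] is the
   orthogonal projection onto [Wj]. *)
Definition schur_topology W0 W1 : topologicalType :=
  initial_topology (@schur_map W0 W1).

(* A sequence of operators converges in the Schur topology when it lies in the
   domain of that topology and converges there. *)
Definition schur_cvg W0 W1 (a_ : nat -> 'Lb(H, H)) (a : schur_domain W0 W1) :=
  exists2 b_ : nat -> schur_domain W0 W1, (forall n, \val (b_ n) = a_ n) &
    (b_ : nat -> schur_topology W0 W1) @ \oo --> (a : schur_topology W0 W1).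

Definition wot_cvg (S_ : nat -> 'Lb(H, H)) (S : 'Lb(H, H)) : Prop :=
  (S_ : nat -> wot H H) @ \oo --> (S : wot H H).

End SchurTopology.

Record operator (R : realType) (H : preHilbertType R) := Operator {
  dom : subspace H;
  op_fun :> {linear elt dom -> H}
}.

Section UnboundedOperators.
Context {R : realType} {H : preHilbertType R}.
Implicit Types (A B : operator H) (T : 'Lb(H, H)).

Definition graph A : set (H * H) :=
  [set p | exists2 u : elt (dom A), emb u = p.1 & A u = p.2].

Definition densely_defined A : Prop := dense (dom A : set H).

(* The graph of [A^*], a functional relation when [A] is densely defined. *)
Definition adjoint_graph A : set (H * H) :=
  [set p | forall u : elt (dom A), inner (A u) p.1 = inner (emb u) p.2].

Definition skew_selfadjoint A : Prop :=
  densely_defined A /\ graph A = [set p | adjoint_graph A (p.1, - p.2)].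

Lemma ker_subspace A (a : R[i]) (x y : H) :
  [set emb u | u in [set u | A u = 0]] x ->
  [set emb u | u in [set u | A u = 0]] y ->
  [set emb u | u in [set u | A u = 0]] (a *: x + y).
Proof.
move=> [u Au0 <-] [v Av0 <-]; exists (a *: u + v) => //.
by rewrite /= linearP /= Au0 Av0 scaler0 addr0.
Qed.

Lemma ker0 A : [set emb u | u in [set u | A u = 0]] 0.
Proof. by exists 0 => //=; rewrite linear0. Qed.

Definition ker A : subspace H := Subspace (ker0 A) (@ker_subspace A).

Lemma ran_subspace A (a : R[i]) (x y : H) :
  range A x -> range A y -> range A (a *: x + y).
Proof.
by move=> [u _ <-] [v _ <-]; exists (a *: u + v) => //; rewrite linearP.
Qed.

Lemma ran0 A : range A 0.
Proof. by exists 0 => //; rewrite linear0. Qed.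

Definition ran A : subspace H := Subspace (ran0 A) (@ran_subspace A).

Definition graph_norm A (u : elt (dom A)) : R[i] :=
  sqrtC (`|u| ^+ 2 + `|A u| ^+ 2).

(* Compactness of the embedding into [H] of [dom A `&` orthogonal (ker A)] with
   the graph norm: bounded sets have relatively compact image. *)
Definition compact_embedding A : Prop := forall M : R[i],
  precompact [set emb u | u in
    [set u : elt (dom A) | orthogonal (ker A) (emb u) /\ graph_norm u <= M]].

Definition op_add_fun T A (u : elt (dom A)) : H := T (emb u) + A u.

Lemma op_add_linear T A : linear (@op_add_fun T A).
Proof.
by move=> a u v; rewrite /op_add_fun (linearP A) (linearP T) scalerDr addrACA.
Qed.

HB.instance Definition _ T A :=
  GRing.isLinear.Build R[i] (elt (dom A)) H *:%R (@op_add_fun T A)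
    (@op_add_linear T A).

Definition op_add T A : operator H := @Operator R H (dom A) (@op_add_fun T A).

Definition is_op_inverse B (S : 'Lb(H, H)) : Prop :=
  (forall u : elt (dom B), S (B u) = emb u) /\
  (forall x, exists2 u : elt (dom B), emb u = S x & B u = x).

Definition op_inv B : 'Lb(H, H) := xget 0 [set S | is_op_inverse B S].

Lemma op_invE B S : is_op_inverse B S -> op_inv B = S.
Proof.
move=> BS; rewrite /op_inv; case: xgetP => [S' _ [S'B _]|/(_ S)/(_ BS)//].
by apply/val_inj/funext => x /=; have [u <- Bu] := BS.2 x; rewrite -{1}Bu S'B.
Qed.

End UnboundedOperators.

(* Main.v *)
(* Write P and Q for the orthogonal projections onto ker A and ran A = (ker A)^perp;
   the range is closed because compactness gives |u| <= C |A u| on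
   dom A `&` (ker A)^perp. Convergence in the Schur topology is weak operator
   convergence of the partial inverse theta(T), defined by
     theta(T) (P T u + Q u) = P u + Q T u.
   Since <theta(T) x, x> and <T u, u> have the same real part for
   x = P T u + Q u, the operators theta(T) with T in F(alpha, beta) are uniformly
   bounded and uniformly coercive, and F(alpha, beta) is stable under limits.
   If (T + A) u = f, then x = P f + Q u satisfies theta(T) x = P u + Q f - A u.

   (i) => (ii): for the solutions u_n and u with T_n and T, put d_n = Q (u_n - u).
   By skewness of A, theta(T_n) d_n differs from the weakly null sequence
   r_n = (theta(T) - theta(T_n)) x by a vector whose real inner product with d_n
   vanishes. As d_n stays in a compact set, coercivity gives
   |d_n|^2 <= M Re <d_n, r_n> -> 0, hence u_n -> u weakly.

   (ii) => (i): the weak limit S of the resolvents has dense range in dom A, and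
   S f |-> f - A S f extends to an operator T in F(alpha, beta) with
   S = (T + A)^-1. Then Q u_n -> Q u strongly, which gives the convergence of
   theta(T_n) on the dense set of all P f + Q S f. No extraction of
   subsequences of operators is needed. *)

Require Import Defs.
From HB Require Import structures.
From mathcomp Require Import all_boot all_order all_algebra.
From mathcomp Require Import all_classical all_reals topology normedtype.
From mathcomp Require Import sequences complex.
From mathcomp Require Import ring lra.
Set Implicit Arguments.
Unset Strict Implicit.
Unset Printing Implicit Defensive.
Import Order.TTheory GRing.Theory Num.Theory.
Import numFieldNormedType.Exports.
Local Open Scope classical_set_scope.
Local Open Scope ring_scope.
Local Open Scope complex_scope.

(** * Real inner product and weak convergence *)

Section RealInnerProduct.
Context {R : realType} {H : preHilbertType R}.
Implicit Types (x y z : H) (r : R).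

(* Real parts suffice, since the imaginary part of [inner x y] is
   [rdot x ('i *: y)]. *)
Definition rdot x y : R := complex.Re (inner x y).
Definition nsq x : R := rdot x x.

Lemma innerDl x y z : inner (x + y) z = inner x z + inner y z.
Proof. exact: (linearDl inner z x y). Qed.

Lemma innerZl (a : R[i]) x y : inner (a *: x) y = a * inner x y.
Proof. exact: (linearZl_LR inner y a x). Qed.

Lemma innerC x y : inner x y = (inner y x)^*.
Proof.
have /= := hermitian_subproof (s := inner) x y.
by rewrite expr0 mul1r.
Qed.

Lemma innerZr (a : R[i]) x y : inner x (a *: y) = a^* * inner x y.
Proof. by rewrite innerC innerZl rmorphM /= [in RHS]innerC. Qed.

Lemma inner0l x : inner 0 x = 0.
Proof. by rewrite -(scale0r 0) innerZl mul0r. Qed.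

Lemma inner0r x : inner x 0 = 0.
Proof. by rewrite innerC inner0l rmorph0. Qed.

Lemma innerNr x y : inner x (- y) = - inner x y.
Proof. by rewrite -scaleN1r innerZr rmorphN1 mulN1r. Qed.

Lemma innerDr x y z : inner z (x + y) = inner z x + inner z y.
Proof. by rewrite innerC innerDl rmorphD /= -!innerC. Qed.

Lemma innerBr x y z : inner z (x - y) = inner z x - inner z y.
Proof. by rewrite -scaleN1r innerDr innerZr rmorphN1 mulN1r. Qed.

Lemma rdotC x y : rdot x y = rdot y x.
Proof. by rewrite /rdot innerC; case: (inner y x). Qed.

Lemma rdotDl x y z : rdot (x + y) z = rdot x z + rdot y z.
Proof. by rewrite /rdot innerDl raddfD. Qed.

Lemma rdotZl r x y : rdot (r%:C *: x) y = r * rdot x y.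
Proof.
rewrite /rdot innerZl; case: (inner x y) => a b /=.
by rewrite mul0r subr0.
Qed.

Lemma rdotDr x y z : rdot x (y + z) = rdot x y + rdot x z.
Proof. by rewrite rdotC rdotDl !(rdotC x). Qed.

Lemma rdotNl x y : rdot (- x) y = - rdot x y.
Proof. by rewrite -[LHS]mul1r -scaleN1r -(rmorphN1 (real_complex R)) rdotZl
  mul1r mulN1r. Qed.

Lemma rdotNr x y : rdot x (- y) = - rdot x y.
Proof. by rewrite rdotC rdotNl rdotC. Qed.

Lemma rdotBl x y z : rdot (x - y) z = rdot x z - rdot y z.
Proof. by rewrite rdotDl rdotNl. Qed.

Lemma rdotBr x y z : rdot x (y - z) = rdot x y - rdot x z.
Proof. by rewrite rdotDr rdotNr. Qed.

Lemma rdot0l x : rdot 0 x = 0.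
Proof. by rewrite -(subrr x) rdotBl subrr. Qed.

Lemma rdot0r x : rdot x 0 = 0.
Proof. by rewrite rdotC rdot0l. Qed.

Lemma rdotZr r x y : rdot x (r%:C *: y) = r * rdot x y.
Proof. by rewrite rdotC rdotZl rdotC. Qed.

Lemma Im_inner x y : complex.Im (inner x y) = rdot x ('i *: y).
Proof.
rewrite /rdot innerZr; case: (inner x y) => a b /=.
by rewrite mul0r mulN1r add0r opprK.
Qed.

Lemma rdotZil x y : rdot ('i *: x) y = - complex.Im (inner x y).
Proof. by rewrite /rdot innerZl mulrC ReiNIm. Qed.

Lemma inner_eq0 x y : rdot x y = 0 -> rdot x ('i *: y) = 0 -> inner x y = 0.
Proof.
rewrite -Im_inner /rdot => a b; apply/eqP.
by rewrite eq_complex a b !eqxx.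
Qed.

Lemma normE x : `|x| ^+ 2 = (nsq x)%:C.
Proof.
rewrite sqr_norm_inner /nsq /rdot RRe_real// ger0_real//.
Qed.

Lemma nsq_ge0 x : 0 <= nsq x.
Proof. by rewrite -lecR -normE exprn_ge0. Qed.

Lemma nsq_eq0 x : nsq x = 0 -> x = 0.
Proof.
move=> x0; apply/eqP; rewrite -normr_eq0 -sqrf_eq0 normE x0.
by rewrite eq_complex /= eqxx.
Qed.

Lemma nsqN x : nsq (- x) = nsq x.
Proof. by rewrite /nsq rdotNl rdotNr opprK. Qed.

Lemma nsqBC x y : nsq (x - y) = nsq (y - x).
Proof. by rewrite -nsqN opprB. Qed.

Lemma nsqD x y : nsq (x + y) = nsq x + 2 * rdot x y + nsq y.
Proof. rewrite /nsq rdotDl !rdotDr (rdotC y x); ring. Qed.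

Lemma nsqB x y : nsq (x - y) = nsq x - 2 * rdot x y + nsq y.
Proof. rewrite nsqD nsqN rdotNr; ring. Qed.

Lemma nsqZ r x : nsq (r%:C *: x) = r ^+ 2 * nsq x.
Proof. rewrite /nsq rdotZl rdotZr; ring. Qed.

Lemma nsqZc (k : R[i]) x :
  nsq (k *: x) = (complex.Re k ^+ 2 + complex.Im k ^+ 2) * nsq x.
Proof.
have := normE (k *: x); rewrite normrZ exprMn normE -add_Re2_Im2 -rmorphM.
by move=> /(congr1 (@complex.Re R)).
Qed.

Lemma nsqZi x : nsq ('i *: x) = nsq x.
Proof. by rewrite nsqZc /= expr0n expr1n add0r mul1r. Qed.

Lemma nsq0 : nsq 0 = 0.
Proof. exact: rdot0l. Qed.

Lemma nsqD_le x y : nsq (x + y) <= 2 * nsq x + 2 * nsq y.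
Proof. have := nsq_ge0 (x - y); rewrite nsqB nsqD; lra. Qed.

Lemma nsqB_le x y : nsq (x - y) <= 2 * nsq x + 2 * nsq y.
Proof. by rewrite -(nsqN y) nsqD_le. Qed.

(** The squared norm of [(nsq y) x - (rdot x y) y] is [nsq y] times the difference of the two
    sides. *)
Lemma cauchy_schwarz x y : rdot x y ^+ 2 <= nsq x * nsq y.
Proof.
have [/eqP/nsq_eq0->|y0] := boolP (nsq y == 0).
  by rewrite rdot0r expr0n mulr_ge0 ?nsq_ge0.
have yp : 0 < nsq y by rewrite lt_neqAle eq_sym y0 nsq_ge0.
have := nsq_ge0 ((nsq y)%:C *: x - (rdot x y)%:C *: y).
rewrite nsqB !nsqZ rdotZl rdotZr => h.
rewrite -(ler_pM2l yp); nra.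
Qed.

End RealInnerProduct.

(** * Weak and strong convergence of sequences *)

Section Convergence.
Context {R : realType} {H : preHilbertType R}.
Implicit Types (x y z : H) (r e C : R) (u v w : nat -> H).

(** Both notions use real quantities only, so that all estimates stay in the ordered field [R];
    [slim_cvg] and [cvg_slim] link [slim] to the norm topology. *)
Definition wlim u x := forall y, (fun n => rdot (u n) y) @ \oo --> rdot x y.
Definition slim u x := (fun n => nsq (u n - x)) @ \oo --> (0 : R).

Lemma norm_lt (z : H) e : 0 < e -> (`|z| < e%:C) = (nsq z < e ^+ 2).
Proof.
move=> e0; rewrite -(@ltr_pXn2r _ 2) ?nnegrE ?lecR// ?ltW ?ltcR//.
by rewrite normE -rmorphXn ltcR.
Qed.

Lemma ball_nsq x e y : 0 < e -> ball x e%:C y = (nsq (x - y) < e ^+ 2) :> Prop.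
Proof. by move=> e0; rewrite -norm_lt// -ball_normE. Qed.

Lemma gt0_complex (a : R[i]) : 0 < a -> a = (complex.Re a)%:C /\ 0 < complex.Re a.
Proof.
by case: a => a b; rewrite ltcE /= => /andP[/eqP -> ?].
Qed.

Lemma nbhs_nsq x (e : R) : 0 < e -> nbhs x [set y | nsq (x - y) < e].
Proof.
move=> e0; rewrite -(sqr_sqrtr (ltW e0)).
have s0 : 0 < Num.sqrt e by rewrite sqrtr_gt0.
apply/nbhs_ballP; exists (Num.sqrt e)%:C; first by rewrite /= ltcR.
by move=> y; rewrite ball_nsq.
Qed.

Lemma dense_nsq (W : set H) : dense W ->
  forall x e, 0 < e -> exists2 y, W y & nsq (x - y) < e.
Proof.
move=> dW x e e0; have := nbhs_nsq x e0.
rewrite nbhsE => -[O [oO Ox] OS].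
have [y [Oy Wy]] := dW O (ex_intro _ x Ox) oO.
by exists y => //; exact: OS.
Qed.

Lemma slimP u x : slim u x <->
  forall e, 0 < e -> \forall n \near \oo, nsq (u n - x) < e.
Proof.
rewrite /slim -[X in X <-> _]/(_ @ \oo --> _); split.
  move=> /cvgr0Pnorm_lt h e e0; near=> n.
  by rewrite -[ltLHS]ger0_norm ?nsq_ge0//; near: n; apply: h.
move=> h; apply/cvgr0Pnorm_lt => e e0; near=> n.
by rewrite ger0_norm ?nsq_ge0//; near: n; apply: h.
Unshelve. all: by end_near. Qed.

Lemma slim_cvg u x : slim u x -> u @ \oo --> x.
Proof.
move=> /slimP h; apply/cvg_ballP => e /gt0_complex[-> e0].
near=> n; rewrite ball_nsq// nsqBC; near: n; apply: h.
by rewrite exprn_gt0.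
Unshelve. all: by end_near. Qed.

Lemma cvg_slim u x : u @ \oo --> x -> slim u x.
Proof.
move=> h; apply/slimP => e e0; near=> n; rewrite nsqBC; near: n.
exact: (h _ (nbhs_nsq x e0)).
Unshelve. all: by end_near. Qed.

Lemma normr_lt_sqr (a e : R) : 0 < e -> (`|a| < e) = (a ^+ 2 < e ^+ 2).
Proof.
move=> e0; rewrite -(real_normK (num_real a)).
by rewrite ltr_pXn2r ?nnegrE ?normr_ge0 ?ltW.
Qed.

Lemma rdot_small u v C : slim u 0 -> (forall n, nsq (v n) <= C) ->
  (fun n => rdot (u n) (v n)) @ \oo --> (0 : R).
Proof.
move=> /slimP u0 vC; have C0 : 0 <= C by rewrite (le_trans _ (vC 0)) ?nsq_ge0.
apply/cvgr0Pnorm_lt => e e0; near=> n.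
(* The [+ 1] keeps the divisor positive when [C = 0]. *)
have : nsq (u n - 0) < e ^+ 2 / (C + 1).
  by near: n; apply: u0; rewrite divr_gt0 ?exprn_gt0// ltr_wpDl.
rewrite subr0 ltr_pdivlMr ?ltr_wpDl// => h.
rewrite normr_lt_sqr// (le_lt_trans (cauchy_schwarz _ _))// (le_lt_trans _ h)//.
by rewrite ler_wpM2l ?nsq_ge0// (le_trans (vC n))// lerDl.
Unshelve. all: by end_near. Qed.

Lemma slim_cst x : slim (fun=> x) x.
Proof. by rewrite /slim subrr nsq0; exact: cvg_cst. Qed.

Lemma slim_sub0 u x : slim u x <-> slim (fun n => u n - x) 0.
Proof. by rewrite /slim; under [X in _ <-> X @ _ --> _]eq_fun do rewrite subr0. Qed.

Lemma slim_wlim u x : slim u x -> wlim u x.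
Proof.
move=> /slim_sub0 ux y; apply: cvg_sub0 (cvg_cst (rdot x y)).
rewrite [X in X @ _](_ : _ = (fun n => rdot (u n - x) y)).
  exact: (@rdot_small _ (fun=> y) (nsq y)).
by apply/funext => n; rewrite rdotBl.
Qed.

Lemma wlim_unique u x y : wlim u x -> wlim u y -> x = y.
Proof.
move=> ux uy; apply/eqP; rewrite -subr_eq0; apply/eqP/nsq_eq0.
rewrite /nsq rdotBl; apply/eqP; rewrite subr_eq0; apply/eqP.
by apply: cvg_unique (ux _) (uy _); apply: norm_hausdorff.
Qed.

Lemma wlim_cst x : wlim (fun=> x) x.
Proof. by move=> y; exact: cvg_cst. Qed.

Lemma wlimD u v x y : wlim u x -> wlim v y -> wlim (fun n => u n + v n) (x + y).
Proof.
move=> ux vy z; rewrite rdotDl; under eq_fun do rewrite rdotDl.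
exact: cvgD.
Qed.

Lemma wlimN u x : wlim u x -> wlim (fun n => - u n) (- x).
Proof.
move=> ux z; rewrite rdotNl; under eq_fun do rewrite rdotNl.
exact: cvgN.
Qed.

Lemma wlimB u v x y : wlim u x -> wlim v y -> wlim (fun n => u n - v n) (x - y).
Proof. by move=> ux vy; apply: wlimD => //; exact: wlimN. Qed.

Lemma wlim_sub0 u x : wlim u x <-> wlim (fun n => u n - x) 0.
Proof.
split=> [ux|h]; first by rewrite -(subrr x); apply: wlimB => //; apply: wlim_cst.
have := wlimD h (@wlim_cst x); rewrite add0r.
by under eq_fun do rewrite subrK.
Qed.

(* [2 rdot x_n x - nsq x <= nsq x_n] makes the bound linear in [x_n]. *)
Lemma wlim_nsq_le u x (f : nat -> R) l C : 0 <= C -> wlim u x ->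
  f @ \oo --> l -> (forall n, C * nsq (u n) <= f n) -> C * nsq x <= l.
Proof.
move=> C0 ux fl h.
have e : C * nsq x = C * (2 * rdot x x - nsq x) by rewrite /nsq; ring.
rewrite e; apply: (@ler_cvg_to _ \oo _ _ (fun n => C * (2 * rdot (u n) x - nsq
  x)) f) => //.
  apply: cvgMr; apply: cvgB; last exact: cvg_cst.
  by apply: cvgMr; exact: (ux x).
near=> n; apply: le_trans (h n); rewrite ler_wpM2l//.
have := nsq_ge0 (u n - x); rewrite nsqB; lra.
Unshelve. all: by end_near. Qed.

(** Since [u n] and [x] are bounded by [C], replacing the test vector [y] by a nearby [z] in [D]
    costs less than [e / 3] in each pairing. *)
Lemma wlim_dense u x (D : set H) C : (forall n, nsq (u n) <= C) -> nsq x <= C ->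
  (forall y e, 0 < e -> exists2 z, D z & nsq (y - z) < e) ->
  (forall z, D z -> (fun n => rdot (u n) z) @ \oo --> rdot x z) -> wlim u x.
Proof.
move=> uC xC dD h y; apply/cvgrPdist_lt => e e0.
have C0 : 0 <= C by rewrite (le_trans _ xC) ?nsq_ge0.
have [|z Dz zy] := dD y (e ^+ 2 / (36 * (C + 1))).
  by rewrite divr_gt0 ?exprn_gt0// mulr_gt0// ltr_wpDl.
have hv (t : H) : nsq t <= C -> `|rdot t (y - z)| < e / 3.
  move=> tC; rewrite normr_lt_sqr ?divr_gt0// (le_lt_trans (cauchy_schwarz _ _))//.
  move: zy; rewrite ltr_pdivlMr ?mulr_gt0 ?ltr_wpDl// => zy.
  have := nsq_ge0 (y - z); have := nsq_ge0 t; nra.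
near=> n.
have h1 : `|rdot x z - rdot (u n) z| < e / 3.
  near: n; have /cvgrPdist_lt := h z Dz; apply; by rewrite divr_gt0.
have -> : rdot x y - rdot (u n) y =
  rdot x (y - z) - rdot (u n) (y - z) + (rdot x z - rdot (u n) z).
  by rewrite !rdotBr; ring.
have := hv _ (uC n); have := hv _ xC; move: h1.
rewrite !ltr_norml => /andP[? ?] /andP[? ?] /andP[? ?]; apply/andP; split; lra.
Unshelve. all: by end_near. Qed.

End Convergence.

(** * Completeness and nearest points in closed subspaces *)

Section Complete.
Context {R : realType} {H : hilbertType R}.

Lemma nsq_cauchy (u : nat -> H) :
  (forall e : R, 0 < e -> exists N, forall m n, (N <= m)%N -> (N <= n)%N ->
     nsq (u m - u n) < e) -> exists x, slim u x.
Proof.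
move=> h; have /cauchy_cvgP : cauchy (u @ \oo).
  apply: cauchy_exP => e /gt0_complex[-> e0].
  have [|N hN] := h (complex.Re e ^+ 2); first by rewrite exprn_gt0.
  exists (u N); exists N => // n /= Nn; rewrite ball_nsq//; exact: hN.
by move=> /cvg_ex[x ux]; exists x; exact: cvg_slim.
Qed.

Definition closed_sub (W : Defs.subspace H) := forall (u : nat -> H) x,
  (forall n, subspace_set W (u n)) -> slim u x -> subspace_set W x.

(** A sequence minimizing the distance to [x] is Cauchy by the parallelogram law; its limit attains
    the distance, and the first variation there gives orthogonality. *)
Lemma projection_exists (W : Defs.subspace H) : closed_sub W ->
  forall x, exists2 y, subspace_set W y & forall z, subspace_set W z -> rdot (x
    - y) z = 0.
Proof.
move=> cW x; pose D := [set nsq (x - y) | y in (W : set H)].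
have D0 : has_inf D.
  split; first by exists (nsq (x - 0)); exists 0 => //; exact: subspace0.
  by exists 0 => _ [y _ <-]; exact: nsq_ge0.
have lbD y : subspace_set W y -> inf D <= nsq (x - y).
  by move=> Wy; apply: ge_inf; [case: D0|exists y].
have /choice[u hu] : forall n : nat, exists y, subspace_set W y /\ nsq (x - y)
  < inf D + n.+1%:R^-1.
  move=> n; have [_ [y Wy <-] hy] := inf_adherent (eps := n.+1%:R^-1 : R)
    ltac:(by rewrite invr_gt0) D0.
  by exists y.
have Wc y z : subspace_set W y -> subspace_set W z -> subspace_set W (2^-1%:C *: (y + z)).
  move=> Wy Wz; rewrite -[_ *: _]addr0; apply: subspaceP; last exact: subspace0.
  by rewrite -[y]scale1r; exact: subspaceP.
(* Parallelogram law for [x - y] and [x - z], whose mean is [x] minus the midpoint of [y] and [z], a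
   point of [W]. *)
have mid y z : subspace_set W y -> subspace_set W z -> nsq (y - z) <= 2 * nsq
  (x - y) + 2 * nsq (x - z) - 4 * inf D.
  move=> Wy Wz; have := lbD _ (Wc _ _ Wy Wz).
  rewrite !nsqB nsqZ rdotZr nsqD rdotDr => h.
  have := h; nra.
have [|y uy] := @nsq_cauchy u.
  move=> e e0; have e4 : 0 < e / 4 by lra.
  have /cvgr0Pnorm_lt/(_ _ e4)[N _ hN] := @cvg_harmonic R.
  exists N => m n Nm Nn.
  have := hN _ Nm; have := hN _ Nn; rewrite /= !ger0_norm ?invr_ge0// => h1 h2.
  have [Wm hm] := hu m; have [Wn hn] := hu n.
  have := mid _ _ Wm Wn; move: h1 h2 hm hn.
  by move: (n.+1%:R^-1) (m.+1%:R^-1) => a b; lra.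
have Wy : subspace_set W y by apply: cW uy => n; have [] := hu n.
have miny : nsq (x - y) <= inf D.
  rewrite -[leLHS]mul1r.
  apply: (@wlim_nsq_le _ _ (fun n => x - u n) _ (fun n => inf D + n.+1%:R^-1)) => //.
  - by apply: wlimB; [exact: wlim_cst|exact: slim_wlim].
  - rewrite -[X in _ --> X]addr0; apply: cvgD; first exact: cvg_cst.
    exact: cvg_harmonic.
  - by move=> n; rewrite mul1r ltW//; have [] := hu n.
exists y => // z Wz; set d := rdot (x - y) z.
(* Comparison of the minimizer [y] with [y + t z]. The choice [t = d / (nsq z + 1)] below avoids a
   division by zero and forces [d = 0]. *)
have h (t : R) : 2 * t * d <= t ^+ 2 * nsq z.
  have Wt : subspace_set W (t%:C *: z + y) by exact: subspaceP.
  have := le_trans miny (lbD _ Wt).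
  have -> : x - (t%:C *: z + y) = (x - y) - t%:C *: z by rewrite opprD addrA addrAC.
  rewrite [leRHS]nsqB nsqZ rdotZr -/d; lra.
have q0 : 0 < nsq z + 1 by rewrite ltr_wpDl ?nsq_ge0.
apply/eqP; rewrite -sqrf_eq0 eq_le sqr_ge0 andbT.
have := h (d / (nsq z + 1)).
rewrite -(ler_pM2l (exprn_gt0 2 q0)).
have -> : (nsq z + 1) ^+ 2 * (2 * (d / (nsq z + 1)) * d) = 2 * (nsq z + 1) * d ^+ 2.
  by field; rewrite gt_eqF.
have -> : (nsq z + 1) ^+ 2 * ((d / (nsq z + 1)) ^+ 2 * nsq z) = nsq z * d ^+ 2.
  by field; rewrite gt_eqF.
have := nsq_ge0 z; have := sqr_ge0 d; nra.
Qed.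

End Complete.

(** * Bounded operators and strong limits *)

Section BoundedOperators.
Context {R : realType}.
Implicit Types U V : preHilbertType R.

Lemma ge0_complex (a : R[i]) : 0 <= a -> exists r : R, a = r%:C /\ 0 <= r.
Proof. by case: a => a b; rewrite lecE /= => /andP[/eqP -> ?]; exists a. Qed.

(** The constant in [bop_bounded] lives in [R[i]]; the square of its modulus is a nonnegative real
    bound for squared norms. *)
Lemma bop_nsq U V (a : 'Lb(U, V)) :
  exists2 C : R, 0 <= C & forall x, nsq (a x) <= C * nsq x.
Proof.
have [M aM] := bop_bounded a.
have [C [MC C0]] := ge0_complex (exprn_ge0 2 (normr_ge0 M)).
exists C => // x; rewrite -lecR rmorphM /= -!normE -MC.
rewrite -exprMn ler_pXn2r ?nnegrE ?mulr_ge0// -[X in _ * X]normr_id -normrM.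
by rewrite ger0_norm ?aM// (le_trans _ (aM x)).
Qed.

Lemma bop_of_linear U V (f : U -> V) (C : R) : linear f ->
  (forall x, nsq (f x) <= C * nsq x) -> exists a : 'Lb(U, V), forall x, a x = f x.
Proof.
move=> lf fC; have [C0|C0] := leP 0 C; last first.
  have f0 x : f x = 0.
    apply: nsq_eq0; apply/eqP; rewrite eq_le nsq_ge0 andbT.
    by rewrite (le_trans (fC x))// nmulr_rle0 ?nsq_ge0.
  by exists 0 => x; rewrite f0.
have fb : f \in bounded_linear_pred U V.
  apply/asboolP; split=> //; exists (Num.sqrt C)%:C => x.
  have s0 : 0 <= (Num.sqrt C)%:C :> R[i] by rewrite lecR sqrtr_ge0.
  rewrite -(@ler_pXn2r _ 2) ?nnegrE ?mulr_ge0//.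
  by rewrite exprMn !normE -rmorphXn -rmorphM lecR sqr_sqrtr.
by exists (Bop fb).
Qed.

Lemma bopB U V (a : 'Lb(U, V)) x y : a (x - y) = a x - a y.
Proof. exact: linearB. Qed.

Lemma bopD U V (a : 'Lb(U, V)) x y : a (x + y) = a x + a y.
Proof. exact: linearD. Qed.

Lemma embB U (W : Defs.subspace U) (x y : elt W) : emb (x - y) = emb x - emb y.
Proof. by []. Qed.

Lemma slim_le U V (u : nat -> U) (v : nat -> V) x y (C : R) : slim u x -> 0 <= C ->
  (forall n, nsq (v n - y) <= C * nsq (u n - x)) -> slim v y.
Proof.
move=> ux C0 h; apply: (@squeeze_cvgr _ _ _ _ (fun=> 0) (fun n => C * nsq (u n - x))).
- by near=> n; rewrite nsq_ge0 h.
- exact: cvg_cst.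
- by rewrite -(mulr0 C); apply: cvgMr.
Unshelve. all: by end_near. Qed.

Lemma bop_slim U V (a : 'Lb(U, V)) u x : slim u x -> slim (fun n => a (u n)) (a x).
Proof.
have [C C0 aC] := bop_nsq a => ux; apply: (slim_le ux C0) => n.
by rewrite -raddfB aC.
Qed.

Lemma slim_lin U (u v : nat -> U) x y (k : R[i]) : slim u x -> slim v y ->
  slim (fun n => k *: u n + v n) (k *: x + y).
Proof.
move=> ux vy; apply: cvg_slim; apply: cvgD; last exact: slim_cvg.
by apply: cvgZr; exact: slim_cvg.
Qed.

Lemma slim_nsq U (u : nat -> U) x : slim u x -> (fun n => nsq (u n)) @ \oo --> nsq x.
Proof.
move=> ux; rewrite [X in X @ _](_ : _ =
  (fun n => nsq (u n - x) + 2 * rdot (u n) x - nsq x)); last first.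
  by apply/funext => n; rewrite nsqB; ring.
rewrite [X in _ --> X](_ : _ = 0 + 2 * rdot x x - nsq x); last by rewrite /nsq; ring.
apply: cvgB; last exact: cvg_cst.
apply: cvgD; first exact: ux.
by apply: cvgMr; exact: (slim_wlim ux).
Qed.

Lemma slim_rdot U (u v : nat -> U) x y : slim u x -> slim v y ->
  (fun n => rdot (u n) (v n)) @ \oo --> rdot x y.
Proof.
have polar (a b : U) : rdot a b = 2^-1 * (nsq (1 *: a + b) - nsq a - nsq b).
  by rewrite scale1r nsqD; field.
move=> ux vy; rewrite polar.
rewrite [X in X @ _](_ : _ = (fun n =>
  2^-1 * (nsq (1 *: u n + v n) - nsq (u n) - nsq (v n)))); last first.
  by apply/funext => n; exact: polar.
by apply: cvgMr; apply: cvgB; [apply: cvgB|]; apply: slim_nsq => //; exact: slim_lin.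
Qed.

Lemma slim_cauchy U (u : nat -> U) x : slim u x -> forall e : R, 0 < e ->
  exists N, forall m n, (N <= m)%N -> (N <= n)%N -> nsq (u m - u n) < e.
Proof.
move=> /slimP h e e0; have e4 : 0 < e / 4 by lra.
have [N _ hN] := h _ e4; exists N => m n /hN /= hm /hN /= hn.
have := nsqB_le (u m - x) (u n - x); rewrite opprB addrA subrK; lra.
Qed.

Lemma slim_unique U (u : nat -> U) x y : slim u x -> slim u y -> x = y.
Proof. by move=> /slim_wlim ux /slim_wlim /(wlim_unique ux). Qed.

End BoundedOperators.

(** * Projections, Riesz representation and inverses *)

Section Riesz.
Context {R : realType} {H : hilbertType R}.
Implicit Types (W D : Defs.subspace H) (x y z : H).

(** Real orthogonality to [W] becomes complex orthogonality because [W] is stable under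
    multiplication by ['i]. *)
Lemma projection_inner W : closed_sub W ->
  forall x, exists2 y, subspace_set W y & forall z, subspace_set W z -> inner
    (x - y) z = 0.
Proof.
move=> cW x; have [y Wy h] := projection_exists cW x; exists y => // z Wz.
apply: inner_eq0; first exact: h.
by apply: h; rewrite -[_ *: _]addr0; apply: subspaceP => //; exact: subspace0.
Qed.

Definition kernel_at (a : 'Lb(H, H)) y : set H := [set x | inner (a x) y = 0].

Lemma kernel_at0 a y : kernel_at a y 0.
Proof. by rewrite /kernel_at /= raddf0 inner0l. Qed.

Lemma kernel_atP a y (k : R[i]) u v : kernel_at a y u -> kernel_at a y v ->
  kernel_at a y (k *: u + v).
Proof.
rewrite /kernel_at /= => h1 h2.
by rewrite linearP innerDl innerZl h1 h2 mulr0 addr0.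
Qed.

Definition kernel_sub a y := Subspace (kernel_at0 a y) (@kernel_atP a y).

Lemma kernel_sub_closed a y : closed_sub (kernel_sub a y).
Proof.
move=> u x uK /(bop_slim a)/slim_wlim ux; apply: inner_eq0.
  apply: cvg_unique (ux y) _; first exact: norm_hausdorff.
  rewrite [X in X @ _](_ : _ = fun=> 0); first exact: cvg_cst.
  by apply/funext => n; rewrite /rdot uK.
apply: cvg_unique (ux ('i *: y)) _; first exact: norm_hausdorff.
rewrite [X in X @ _](_ : _ = fun=> 0); first exact: cvg_cst.
by apply/funext => n; rewrite -Im_inner uK.
Qed.

(** Riesz representation of [x |-> inner (a x) y]: if it is nonzero, a vector [e] orthogonal to its
    closed kernel represents it up to a scalar. *)
Lemma adjoint_at (a : 'Lb(H, H)) y : exists z, forall x, inner (a x) y = inner x z.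
Proof.
have [h|/existsNP[x0 fx0]] := pselect (forall x, inner (a x) y = 0).
  by exists 0 => x; rewrite h innerC inner0l rmorph0.
have [w Ww hw] := projection_inner (@kernel_sub_closed a y) x0.
set e := x0 - w; pose f x := inner (a x) y.
have fD k u v : f (k *: u + v) = k * f u + f v.
  by rewrite /f linearP innerDl innerZl.
have fw : f w = 0 by exact: Ww.
have fe : f e = f x0 by rewrite /e addrC -scaleN1r fD fw mulr0 add0r.
have fe0 : f e != 0 by rewrite fe; apply/eqP.
have ee0 : inner e e != 0.
  apply/eqP => ee; move: fe0; have -> : e = 0 by apply: nsq_eq0; rewrite /nsq /rdot ee.
  by rewrite /f raddf0 inner0l eqxx.
exists ((f e / inner e e)^* *: e) => x.
have : inner e (- (f x / f e) *: e + x) = 0.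
  by apply: hw; rewrite /= /kernel_at /= -/(f _) fD mulNr divfK// addNr.
rewrite innerC innerDl innerZl => /eqP; rewrite conjC_eq0 mulNr addrC subr_eq0 => /eqP h.
by rewrite innerZr conjCK h -/(f x); field; rewrite fe0 ee0.
Qed.

(** The lower bound and the closed graph make the range of [L] closed; the difference of [y] and its
    projection onto the range lies in [W], is orthogonal to the range, and so vanishes. *)
Lemma closed_range D W (L : {linear elt D -> H}) (c : R) : 0 < c ->
  (forall u, c * nsq (emb u) <= nsq (L u)) ->
  (forall (u : nat -> elt D) x y, slim (fun n => emb (u n)) x ->
     slim (fun n => L (u n)) y -> exists2 v, emb v = x & L v = y) ->
  (forall u, subspace_set W (L u)) ->
  (forall y, subspace_set W y -> (forall u, inner y (L u) = 0) -> y = 0) ->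
  forall y, subspace_set W y -> exists u, L u = y.
Proof.
move=> c0 Lc Lcl LW Lperp y Wy.
have rg0 : range L 0 by exists 0 => //; rewrite linear0.
have rgP (k : R[i]) x z : range L x -> range L z -> range L (k *: x + z).
  by move=> [u _ <-] [v _ <-]; exists (k *: u + v) => //; rewrite linearP.
have [|z [v _ Lv] hz] := @projection_inner (Subspace rg0 rgP) _ y.
  move=> z_ z rz zz.
  have /choice[u Lu] : forall n, exists u, L u = z_ n.
    by move=> n; have [u _ <-] := rz n; exists u.
  have [|x ux] := @nsq_cauchy _ _ (fun n => emb (u n)).
    move=> e e0; have [N hN] := slim_cauchy zz (mulr_gt0 c0 e0).
    exists N => m n Nm Nn; rewrite -(ltr_pM2l c0).
    apply: le_lt_trans (hN m n Nm Nn).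
    by rewrite -!Lu -raddfB (le_trans _ (Lc _)).
  have [|w _ <-] := Lcl u x z ux; last by exists w.
  by rewrite (_ : (fun n => _) = z_)//; apply/funext.
exists v; apply/eqP; rewrite eq_sym -subr_eq0; apply/eqP; apply: Lperp.
  by rewrite addrC -scaleN1r; apply: subspaceP => //; exact: LW.
by move=> u; rewrite Lv; apply: hz; exists u.
Qed.

(** The Lax-Milgram argument: coercivity bounds [f] below by Cauchy-Schwarz, and a [y] in [W]
    orthogonal to the range satisfies [rdot y (f y) = 0], hence [y = 0]. *)
Lemma closed_sub_coercive_onto W (f : {linear elt W -> H}) (c C : R) :
  closed_sub W -> 0 < c -> (forall u, subspace_set W (f u)) ->
  0 <= C -> (forall u, nsq (f u) <= C * nsq (emb u)) ->
  (forall u, c * nsq (emb u) <= rdot (emb u) (f u)) ->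
  forall y, subspace_set W y -> exists u, f u = y.
Proof.
move=> cW c0 fW C0 fC fc; apply: (@closed_range W W f (c ^+ 2)) => //.
- by rewrite exprn_gt0.
- move=> u; have := nsq_ge0 (f u - c%:C *: emb u).
  rewrite nsqB nsqZ rdotZr (rdotC (f u)); have := fc u; nra.
- move=> u x y ux uy.
  have Wx : subspace_set W x.
    by apply: cW ux => n; have /asboolP := eltP (u n).
  have Ex : x \in subspace_pred W by apply/asboolP.
  exists (Elt Ex) => //; apply: slim_unique uy.
  by apply: (slim_le ux C0) => n; rewrite -raddfB fC.
- move=> y Wy hy; apply: nsq_eq0; apply/eqP; rewrite eq_le nsq_ge0 andbT.
  have Ey : y \in subspace_pred W by apply/asboolP.
  rewrite -(pmulr_rle0 _ c0); have := fc (Elt Ey).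
  by rewrite /= /rdot hy.
Qed.

End Riesz.

(** * Inverses of coercive operators and extension by continuity *)

Section Inverses.
Context {R : realType}.

(** The estimate forces [j x = 0] whenever [L x = 0], so [j] factors through [L]. The space [X]
    carries no norm, which lets [L] be an unbounded operator on its domain. *)
Lemma bop_factor (X : lmodType R[i]) (V W : preHilbertType R)
    (L : {linear X -> V}) (j : {linear X -> W}) (C : R) :
  (forall x, nsq (j x) <= C * nsq (L x)) -> (forall y, exists x, L x = y) ->
  exists S : 'Lb(V, W), forall x, S (L x) = j x.
Proof.
move=> jC /choice[g Lg].
have ker x : L x = 0 -> j x = 0.
  move=> Lx; apply: nsq_eq0; apply/eqP; rewrite eq_le nsq_ge0 andbT.
  by rewrite (le_trans (jC x))// Lx nsq0 mulr0.
have jg x y : L x = y -> j (g y) = j x.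
  move=> Lx; apply/eqP; rewrite -subr_eq0.
  have -> : j (g y) - j x = j (g y - x) by rewrite linearB.
  rewrite ker//.
  by rewrite linearB Lg Lx subrr.
have [|y|S hS] := @bop_of_linear _ V W (fun y => j (g y)) C.
- by move=> k x y; rewrite -linearP; apply: jg; rewrite linearP !Lg.
- by rewrite -{2}(Lg y).
by exists S => x; rewrite hS; exact: jg.
Qed.

Lemma bounded_below_invertible (U V : preHilbertType R) (a : 'Lb(U, V)) (c : R) :
  0 < c -> (forall x, c * nsq x <= nsq (a x)) -> (forall y, exists x, a x = y) ->
  invertible a.
Proof.
move=> c0 ca onto.
have [|S hS] := @bop_factor U V U a idfun c^-1 _ onto.
  by move=> x; rewrite ler_pdivlMl.
by exists S; split => // y; have [x <-] := onto y; rewrite hS.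
Qed.

(** Expand [nsq (a x - c x) >= 0]. Since [a] is a plain function, a constant one turns this into a
    statement about two vectors. *)
Lemma coercive_bounded_below (U : preHilbertType R) (a : U -> U) (c : R) x :
  0 <= c -> c * nsq x <= rdot x (a x) -> c ^+ 2 * nsq x <= nsq (a x).
Proof.
move=> c0 h; have := nsq_ge0 (a x - c%:C *: x).
rewrite nsqB nsqZ rdotZr (rdotC (a x)); nra.
Qed.

End Inverses.

Section HilbertInverses.
Context {R : realType} {H : hilbertType R}.

Lemma fullT0 : [set: H] 0. Proof. by []. Qed.
Lemma fullTP (k : R[i]) (x y : H) : [set: H] x -> [set: H] y -> [set: H] (k *: x + y).
Proof. by []. Qed.
(** Makes the results on closed subspaces applicable to the whole space. *)
Definition full_sub := Subspace fullT0 fullTP.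

Lemma coercive_invertible (a : 'Lb(H, H)) (c : R) : 0 < c ->
  (forall x, c * nsq x <= rdot x (a x)) -> invertible a.
Proof.
move=> c0 ac; have [C C0 aC] := bop_nsq a.
apply: (@bounded_below_invertible _ _ _ a (c ^+ 2)); first by rewrite exprn_gt0.
  by move=> x; apply: coercive_bounded_below; [exact: ltW|exact: ac].
move=> y.
have [] := @closed_sub_coercive_onto _ H full_sub (bop_comp a (bemb full_sub)) c C
  _ c0 _ C0 _ _ y => //.
  by move=> u; exact: aC.
by move=> u <-; exists (emb u).
Qed.

Lemma closed_sub_coercive_invertible (W : Defs.subspace H)
    (a : 'Lb(elt W, elt W)) (c : R) : closed_sub W -> 0 < c ->
  (forall x, c * nsq (emb x) <= rdot (emb x) (emb (a x))) -> invertible a.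
Proof.
move=> cW c0 ac; have [C C0 aC] := bop_nsq a.
apply: (@bounded_below_invertible _ _ _ a (c ^+ 2)); first by rewrite exprn_gt0.
  by move=> x; apply: coercive_bounded_below; [exact: ltW|exact: ac].
move=> y.
have [] := @closed_sub_coercive_onto _ H W (bop_comp (bemb W) a) c C
  cW c0 _ C0 _ _ (emb y) => //.
- by move=> u; have /asboolP := eltP (a u).
- by have /asboolP := eltP y.
by move=> u uy; exists u; exact: val_inj.
Qed.

(** The set [W] is the closure of the range, a closed subspace; the difference of [y] and its
    projection onto [W] is orthogonal to the range. *)
Lemma trivial_orth_dense (a : 'Lb(H, H)) :
  (forall y, (forall x, inner y (a x) = 0) -> y = 0) ->
  forall y (e : R), 0 < e -> exists x, nsq (y - a x) < e.
Proof.
move=> ha.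
pose W : set H := [set y | forall e : R, 0 < e -> exists x, nsq (y - a x) < e].
have W0 : W 0 by move=> e e0; exists 0; rewrite linear0 subrr nsq0.
have WP (k : R[i]) x y : W x -> W y -> W (k *: x + y).
  move=> Wx Wy e e0.
  pose c := complex.Re k ^+ 2 + complex.Im k ^+ 2.
  have c0 : 0 <= c by rewrite addr_ge0 ?sqr_ge0.
  have c1 : 0 < c + 1 by rewrite ltr_wpDl.
  have [|s hs] := Wx (e / 4 / (c + 1)); first by rewrite !divr_gt0.
  have [|t ht] := Wy (e / 4); first by rewrite divr_gt0.
  exists (k *: s + t).
  have -> : k *: x + y - a (k *: s + t) = k *: (x - a s) + (y - a t).
    by rewrite linearP scalerBr opprD addrACA.
  apply: le_lt_trans (nsqD_le _ _) _; rewrite nsqZc -/c.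
  move: hs; rewrite ltr_pdivlMr// => hs.
  have := nsq_ge0 (x - a s); nra.
have cW : closed_sub (Subspace W0 WP).
  move=> z x zW /slimP zx e e0; have e4 : 0 < e / 4 by rewrite divr_gt0.
  have [N _ hN] := zx _ e4; have [t ht] := zW N _ e4; exists t.
  have := hN N (leqnn N); rewrite /= nsqBC => h.
  have := nsqD_le (x - z N) (z N - a t); rewrite addrA subrK; lra.
move=> y; have [z Wz hz] := projection_inner cW y.
suff yz : y - z = 0 by rewrite -(subrK z y) yz add0r.
apply: ha => x; apply: hz => e e0; by exists x; rewrite subrr nsq0.
Qed.

(** The value at [x] is the limit of [j (t n)] for any [t] with [L (t n)] tending to [x]. The
    estimate, passed to the limit in [lim_le], gives independence of [t] and the bound. *)
Lemma bop_extend (X : lmodType R[i]) (V : preHilbertType R)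
    (L : {linear X -> V}) (j : {linear X -> H}) (C : R) : 0 <= C ->
  (forall x, nsq (j x) <= C * nsq (L x)) ->
  (forall y (e : R), 0 < e -> exists x, nsq (y - L x) < e) ->
  exists S : 'Lb(V, H), forall x, S (L x) = j x.
Proof.
move=> C0 jC dL.
have lim_le (t : nat -> X) x y : slim (fun n => L (t n)) x ->
    slim (fun n => j (t n)) y -> nsq y <= C * nsq x.
  move=> tx ty; apply: (@ler_cvg_to _ \oo _ _ (fun n => nsq (j (t n)))
    (fun n => C * nsq (L (t n)))); first exact: slim_nsq.
    by apply: cvgMr; exact: slim_nsq.
  by near=> n; exact: jC.
have /choice[F hF] : forall x, exists y, exists t : nat -> X,
    slim (fun n => L (t n)) x /\ slim (fun n => j (t n)) y.
  move=> x; have /choice[t ht] : forall n : nat, exists t, nsq (x - L t) < n.+1%:R^-1.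
    by move=> n; apply: dL; rewrite invr_gt0.
  have tx : slim (fun n => L (t n)) x.
    apply: (@squeeze_cvgr _ _ _ _ (fun=> 0) harmonic).
    - by near=> n; rewrite nsq_ge0/= nsqBC ltW.
    - exact: cvg_cst.
    - exact: cvg_harmonic.
  have [|y ty] := @nsq_cauchy _ _ (fun n => j (t n)).
    move=> e e0; have C1 : 0 < C + 1 by rewrite ltr_wpDl.
    have [N hN] := slim_cauchy tx (divr_gt0 e0 C1).
    exists N => m n Nm Nn; have := hN m n Nm Nn; rewrite ltr_pdivlMr// => h.
    apply: le_lt_trans h; rewrite -!raddfB mulrC (le_trans (jC _))//.
    by rewrite ler_wpM2r ?nsq_ge0// lerDl.
  by exists y, t.
have uniq x (t : nat -> X) y : slim (fun n => L (t n)) x ->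
    slim (fun n => j (t n)) y -> y = F x.
  move=> tx ty; have [s [sx sy]] := hF x.
  apply/eqP; rewrite -subr_eq0; apply/eqP/nsq_eq0; apply/eqP.
  rewrite eq_le nsq_ge0 andbT addrC -scaleN1r.
  rewrite -(mulr0 C) -(@nsq0 _ V) -(addNr x) -[- x]scaleN1r.
  apply: (lim_le (fun n => -1 *: s n + t n)).
    under eq_fun do rewrite linearP.
 exact: (slim_lin (-1) sx tx).
  by under eq_fun do rewrite linearP; exact: (slim_lin (-1) sy ty).
have [||S hS] := @bop_of_linear _ V H F C.
- move=> k x y; have [s [sx sy]] := hF x; have [t [tx ty]] := hF y.
  apply/esym; apply: (uniq _ (fun n => k *: s n + t n)).
    by under eq_fun do rewrite linearP; exact: (slim_lin k sx tx).
  by under eq_fun do rewrite linearP; exact: (slim_lin k sy ty).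
- by move=> x; have [s [sx sy]] := hF x; exact: lim_le sx sy.
exists S => x; rewrite hS; apply/esym; apply: (uniq _ (fun=> x)); exact: slim_cst.
Unshelve. all: by end_near. Qed.

End HilbertInverses.

(** * Sequences in precompact sets *)

Section Compactness.
Context {R : realType} {H : preHilbertType R}.

Lemma precompact_cluster (S : set H) (u : nat -> H) : precompact S ->
  (forall n, S (u n)) ->
  exists x, forall (e : R) N, 0 < e -> exists2 n, (N <= n)%N & nsq (u n - x) < e.
Proof.
rewrite precompactE => cS Su.
have [|x [_ ux]] := cS (u @ \oo) _.
  by exists 0%N => // n _; apply: subset_closure; exact: Su.
exists x => e N e0.
have [|y [[n Nn <-]]] := ux [set u n | n in [set n | (N <= n)%N]] _ _ (nbhs_nsq x e0).
  by exists N => // n Nn; exists n.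
by rewrite /= nsqBC => h; exists n.
Qed.

(** Each index is chosen separately near a cluster point, so [phi] need not be monotone;
    [n <= phi n] is what later estimates use. *)
Lemma precompact_subseq (S : set H) (u : nat -> H) : precompact S ->
  (forall n, S (u n)) ->
  exists (phi : nat -> nat) x, (forall n, n <= phi n)%N /\ slim (fun n => u (phi n)) x.
Proof.
move=> cS Su; have [x hx] := precompact_cluster cS Su.
have /choice[phi hphi] : forall n : nat, exists k, (n <= k)%N /\ nsq (u k - x)
  < n.+1%:R^-1.
  by move=> n; have [|k] := hx n.+1%:R^-1 n; [rewrite invr_gt0|exists k].
exists phi, x; split; first by move=> n; have [] := hphi n.
apply: (@squeeze_cvgr _ _ _ _ (fun=> 0) harmonic).
- by near=> n; rewrite nsq_ge0/= ltW//; have [] := hphi n.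
- exact: cvg_cst.
- exact: cvg_harmonic.
Unshelve. all: by end_near. Qed.

(* Weak convergence to [0] of a bounded sequence is uniform on precompact sets. *)
Lemma precompact_rdot (S : set H) (d r : nat -> H) (C : R) : precompact S ->
  (forall n, S (d n)) -> (forall n, nsq (r n) <= C) -> wlim r 0 ->
  (fun n => rdot (d n) (r n)) @ \oo --> (0 : R).
Proof.
move=> cS Sd rC r0; apply/cvgr0Pnorm_lt => e e0; apply: contrapT => nh.
have C0 : 0 <= C by rewrite (le_trans _ (rC 0)) ?nsq_ge0.
have /choice[phi hphi] : forall N, exists n, (N <= n)%N /\ e <= `|rdot (d n) (r n)|.
  move=> N; apply: contrapT => /forallNP h; apply: nh; exists N => // n Nn /=.
  by rewrite ltNge; apply/negP => en; apply: (h n).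
(* Near a cluster point [x] of the offending terms, the pairing with [r] is close to that of [x]
   with [r], which tends to zero. *)
have [x hx] := precompact_cluster cS (fun n => Sd (phi n)).
have e2 : 0 < e / 2 by lra.
have := r0 x; rewrite rdot0l => /cvgr0Pnorm_lt/(_ _ e2)[N _ hN].
have [|n Nn hn] := hx ((e / 2) ^+ 2 / (C + 1)) N.
  by rewrite divr_gt0 ?exprn_gt0// ltr_wpDl.
have [le_n] := hphi n; rewrite leNgt => /negP; apply.
have -> : rdot (d (phi n)) (r (phi n)) =
  rdot (d (phi n) - x) (r (phi n)) + rdot (r (phi n)) x.
  by rewrite rdotBl (rdotC x) subrK.
rewrite (le_lt_trans (ler_normD _ _))// [ltRHS]splitr ltrD//; last first.
  by apply: hN => /=; exact: leq_trans le_n.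
rewrite normr_lt_sqr// (le_lt_trans (cauchy_schwarz _ _))//.
move: hn; rewrite ltr_pdivlMr ?ltr_wpDl// => hn; apply: le_lt_trans hn.
by rewrite ler_wpM2l ?nsq_ge0// (le_trans (rC _))// lerDl.
Qed.

End Compactness.

(** * The Schur topology *)

Lemma initial_cvgP (S : choiceType) (T : topologicalType) (f : S -> T)
    (u : nat -> S) (s : S) :
  (u : nat -> initial_topology f) @ \oo --> (s : initial_topology f) <->
  (fun n => f (u n)) @ \oo --> f s.
Proof.
split=> [us|fus].
  by apply: cvg_comp us _; exact: (@initial_continuous _ _ f).
move=> A; rewrite nbhsE => -[_ [[B Bop <-] Bs] BA].
have : nbhs (f s) B by exact: open_nbhs_nbhs.
move=> /fus fB; suff: \forall n \near \oo, A (u n) by [].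
have {}fB : \forall n \near \oo, B (f (u n)) by [].
by apply: filterS fB => n Bn; exact: BA.
Qed.

Lemma pair_cvgP (S T : topologicalType) (u : nat -> S) (v : nat -> T)
    (s : S) (t : T) :
  (fun n => (u n, v n)) @ \oo --> (s, t) <-> u @ \oo --> s /\ v @ \oo --> t.
Proof.
split=> [h|[us vt]]; last exact: cvg_pair.
split.
  exact: (cvg_comp _ _ h cvg_fst).
exact: (cvg_comp _ _ h cvg_snd).
Qed.

(** * Weak operator and Schur convergence as families of weak limits *)

Section WeakOperatorTopology.
Context {R : realType}.
Implicit Types U V : preHilbertType R.

Lemma cvg_inner_wlim V (u : nat -> V) x :
  (forall y, (fun n => inner (u n) y : R[i]^o) @ \oo --> (inner x y : R[i]^o)) <->
  wlim u x.
Proof.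
split=> [h y|h y].
  apply/cvgrPdist_lt => e e0.
  have := h y => /cvgrPdist_lt/(_ e%:C); rewrite ltcR => /(_ e0).
  apply: filterS => n; rewrite -ltcR; apply: le_lt_trans.
  by rewrite /rdot -raddfB; exact: normc_ge_Re.
apply/cvgrPdist_lt => e /gt0_complex[-> e0].
have e2 : 0 < complex.Re e / 2 by lra.
have := h y => /cvgrPdist_lt/(_ _ e2); have := h ('i *: y) => /cvgrPdist_lt/(_ _ e2).
apply: filterS2 => n h1 h2.
have -> : inner x y - inner (u n) y =
  (rdot x y - rdot (u n) y)%:C + 'i * (rdot x ('i *: y) - rdot (u n) ('i *: y))%:C.
  by rewrite -!Im_inner /rdot -!raddfB; exact: complexE.
rewrite (le_lt_trans (ler_normD _ _))// normrM !normc_def /=.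
rewrite !expr0n expr1n !addr0 add0r sqrtr1 mul1r !sqrtr_sqr -rmorphD ltcR.
by rewrite [ltRHS]splitr ltrD.
Qed.

Lemma wot_cvgP U V (a_ : nat -> 'Lb(U, V)) (a : 'Lb(U, V)) :
  (a_ : nat -> wot U V) @ \oo --> (a : wot U V) <->
  forall x, wlim (fun n => a_ n x) (a x).
Proof.
rewrite initial_cvgP; split.
  move=> /pointwise_cvgP h x; apply/cvg_inner_wlim => y; exact: (h (x, y)).
move=> h; apply/pointwise_cvgP => -[x y] /=.
by have := (cvg_inner_wlim _ _).2 (h x) y.
Qed.

End WeakOperatorTopology.

Section SchurCvg.
Context {R : realType} {H : preHilbertType R}.
Variables W0 W1 : Defs.subspace H.

Lemma schur_cvgP (a_ : nat -> 'Lb(H, H)) (a : schur_domain W0 W1) :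
  let A00 b := bop_inv (block W0 W0 b) in
  let A01 b := block W0 W1 b in
  let A10 b := block W1 W0 b in
  let A11 b := block W1 W1 b in
  let b := \val a in
  schur_cvg a_ a <->
  [/\ forall n, schur_domain W0 W1 (a_ n),
    forall x, wlim (fun n => A00 (a_ n) x) (A00 b x),
    forall x, wlim (fun n => A00 (a_ n) (A01 (a_ n) x)) (A00 b (A01 b x)),
    forall x, wlim (fun n => A10 (a_ n) (A00 (a_ n) x)) (A10 b (A00 b x)) &
    forall x, wlim (fun n => A11 (a_ n) x - A10 (a_ n) (A00 (a_ n) (A01 (a_ n) x)))
      (A11 b x - A10 b (A00 b (A01 b x)))].
Proof.
move=> A00 A01 A10 A11 b; split.
  move=> [b_ bE] /initial_cvgP; rewrite /schur_map.
  move=> /pair_cvgP[/pair_cvgP[/pair_cvgP[]]].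
  move=> /wot_cvgP h1 /wot_cvgP h2 /wot_cvgP h3 /wot_cvgP h4.
  have aE : a_ = fun n => \val (b_ n) by apply/funext => n; rewrite bE.
  rewrite aE; split => //.
  by move=> n; exact: set_valP.
move=> [ad h1 h2 h3 h4].
exists (fun n => SigSub (mem_set (ad n))) => //.
apply/initial_cvgP; rewrite /schur_map.
apply/pair_cvgP; split; last exact/wot_cvgP.
by apply/pair_cvgP; split; [apply/pair_cvgP; split|]; apply/wot_cvgP.
Qed.

End SchurCvg.

(** * Orthogonal projections as adjoints of embeddings *)

Section Projection.
Context {R : realType} {H : hilbertType R}.
Implicit Types (W : Defs.subspace H) (x y : H).

Lemma emb_sub W (u : elt W) : subspace_set W (emb u).
Proof. by have /asboolP := eltP u. Qed.

Lemma sub_emb W x : subspace_set W x -> exists u : elt W, emb u = x.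
Proof.
move=> Wx; have Ex : x \in subspace_pred W by apply/asboolP.
by exists (Elt Ex).
Qed.

Definition orth_proj W : 'Lb(H, elt W) := adjoint (bemb W).

(** Since [adjoint] is chosen by description, an adjoint of [bemb W] has to be produced first: the
    nearest-point map, which is linear by orthogonality and contractive. *)
Lemma projP W : closed_sub W -> forall (u : elt W) x,
  inner (emb u) (emb (orth_proj W x)) = inner (emb u) x.
Proof.
move=> cW; have /choice[p hp] : forall x, exists p : elt W,
    forall u : elt W, inner (emb u) (emb p) = inner (emb u) x.
  move=> x; have [y /sub_emb[p <-] h] := projection_inner cW x.
  exists p => u; have := h _ (emb_sub u).
  rewrite innerC => /eqP; rewrite conjC_eq0 => /eqP.
  by rewrite innerBr => /eqP; rewrite subr_eq0 => /eqP.
have [|x|b hb] := @bop_of_linear _ H (elt W) p 1.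
- move=> k x y; apply/eqP; rewrite -subr_eq0; apply/eqP.
  set d := _ - _; suff d0 : inner (emb d) (emb d) = 0.
    by apply: nsq_eq0; rewrite /nsq /rdot [inner d d]d0.
  have dE : emb d = emb (p (k *: x + y)) - (k *: emb (p x) + emb (p y)) by [].
  rewrite {2}dE innerBr !innerDr !innerZr !hp.
  by rewrite innerDr innerZr subrr.
- rewrite mul1r; have := nsq_ge0 (x - emb (p x)).
  have e : rdot (emb (p x)) (emb (p x)) = rdot (emb (p x)) x by rewrite /rdot hp.
  rewrite nsqB (rdotC x) -e /nsq; lra.
move=> u x; suff -> : orth_proj W x = b x by rewrite hb hp.
by rewrite /orth_proj (@adjointE _ _ _ (bemb W) b)// => v y /=; rewrite hb -hp.
Qed.

Lemma proj_id W x : closed_sub W -> subspace_set W x -> emb (orth_proj W x) = x.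
Proof.
move=> cW /sub_emb[u <-]; apply/eqP; rewrite -subr_eq0; apply/eqP/nsq_eq0.
rewrite -[emb _ - _]/(emb (orth_proj W (emb u) - u)) /nsq /rdot [X in inner _
  X]/= innerBr.
by rewrite (projP cW) subrr.
Qed.

Lemma proj_orth W x : closed_sub W -> Defs.orthogonal W x -> orth_proj W x = 0.
Proof.
move=> cW hx; apply: val_inj; apply: nsq_eq0; rewrite /nsq /rdot /=.
by rewrite (projP cW) innerC hx ?rmorph0//; exact: emb_sub.
Qed.

End Projection.

(** * The class [classF] through inequalities without inverses *)

Definition accretive {R : realType} {H : preHilbertType R} (alpha beta : R)
    (a : H -> H) := forall u,
  alpha * nsq u <= rdot u (a u) /\ beta^-1 * nsq (a u) <= rdot u (a u).

Section ClassF.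
Context {R : realType} {H : hilbertType R}.

Lemma re_geE (a : 'Lb(H, H)) (c : R) :
  re_ge a c <-> forall x, c * nsq x <= rdot x (a x).
Proof.
by split=> h x; have := h x; rewrite normE -rmorphM -complexRe lecR.
Qed.

(** Substituting [a u] for the argument of the inverse turns its bound into the second inequality;
    conversely, coercivity supplies the inverse. *)
Lemma classF_accretive (alpha beta : R) (a : 'Lb(H, H)) : 0 < alpha ->
  classF alpha beta a <-> accretive alpha beta a.
Proof.
move=> a0; split.
  move=> [/re_geE h1 [[b hb] /re_geE]]; rewrite (bop_invE hb) => h2 u.
  by split; [exact: h1|have := h2 (a u); rewrite hb.1 rdotC].
move=> h; have inv : invertible a.
  by apply: (coercive_invertible a0) => x; have [] := h x.
split; first by apply/re_geE => x; have [] := h x.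
split => //; have [b hb] := inv; rewrite (bop_invE hb).
by apply/re_geE => x; have [_] := h (b x); rewrite hb.2 rdotC.
Qed.

End ClassF.

(** * Block decomposition and the partial inverse *)

Section Schur.
Context {R : realType} {H : hilbertType R}.
Variables W0 W1 : Defs.subspace H.
Hypotheses (c0 : closed_sub W0) (c1 : closed_sub W1).
Hypothesis orth : forall x y, subspace_set W0 x -> subspace_set W1 y -> inner x y = 0.
Hypothesis dec : forall x, exists2 y, subspace_set W0 y & subspace_set W1 (x - y).
Implicit Types (a : 'Lb(H, H)) (x y u : H).

Let p : 'Lb(H, elt W0) := orth_proj W0.
Let q : 'Lb(H, elt W1) := orth_proj W1.

Lemma p_W1 (v : elt W1) : p (emb v) = 0.
Proof.
apply: proj_orth => // y Wy; rewrite innerC orth ?rmorph0//; exact: emb_sub.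
Qed.

Lemma q_W0 (v : elt W0) : q (emb v) = 0.
Proof. by apply: proj_orth => // y Wy; rewrite orth //; exact: emb_sub. Qed.

Lemma p_W0 (v : elt W0) : p (emb v) = v.
Proof. by apply: val_inj; apply: proj_id => //; exact: emb_sub. Qed.

Lemma q_W1 (v : elt W1) : q (emb v) = v.
Proof. by apply: val_inj; apply: proj_id => //; exact: emb_sub. Qed.

Lemma decE x : x = emb (p x) + emb (q x).
Proof.
have [y /sub_emb[u <-] /sub_emb[v vE]] := dec x.
have -> : x = emb u + emb v by rewrite vE addrC subrK.
by rewrite !raddfD /= p_W0 p_W1 q_W0 q_W1 addr0 add0r.
Qed.

Lemma p_add (u : elt W0) (v : elt W1) : p (emb u + emb v) = u.
Proof. by rewrite raddfD /= p_W0 p_W1 addr0. Qed.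

Lemma q_add (u : elt W0) (v : elt W1) : q (emb u + emb v) = v.
Proof. by rewrite raddfD /= q_W0 q_W1 add0r. Qed.

Lemma blockE Wj Wk a (u : elt Wk) : block Wj Wk a u = orth_proj Wj (a (emb u)).
Proof. by []. Qed.

Lemma p_apply a u : p (a u) = block W0 W0 a (p u) + block W0 W1 a (q u).
Proof. by rewrite !blockE -raddfD /= -raddfD /= -decE. Qed.

Lemma q_apply a u : q (a u) = block W1 W0 a (p u) + block W1 W1 a (q u).
Proof. by rewrite !blockE -raddfD /= -raddfD /= -decE. Qed.

Lemma inner_dec x y : inner x y =
  inner (emb (p x)) (emb (p y)) + inner (emb (q x)) (emb (q y)).
Proof.
have pq (v : elt W0) (w : elt W1) : inner (emb v) (emb w) = 0.
  by apply: orth; exact: emb_sub.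
have qp (v : elt W0) (w : elt W1) : inner (emb w) (emb v) = 0.
  by rewrite innerC pq rmorph0.
by rewrite {1}(decE x) {1}(decE y) innerDl !innerDr pq qp addr0 add0r.
Qed.

Definition a00V a := bop_inv (block W0 W0 a).

(* The partial inverse of [a] that exchanges the [W0]-components of argument and
   value; its four blocks are, up to sign, the four maps defining the Schur
   topology. *)
Definition theta a : 'Lb(H, H) :=
  let b := bop_comp (a00V a) (bop_comp (block W0 W1 a) q) in
  bop_comp (bemb W0) (bop_comp (a00V a) p - b) +
  bop_comp (bemb W1) (bop_comp (block W1 W0 a) (bop_comp (a00V a) p) +
    (bop_comp (block W1 W1 a) q - bop_comp (block W1 W0 a) b)).

Lemma thetaE a x : theta a x =
  emb (a00V a (p x) - a00V a (block W0 W1 a (q x))) +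
  emb (block W1 W0 a (a00V a (p x)) +
    (block W1 W1 a (q x) - block W1 W0 a (a00V a (block W0 W1 a (q x))))).
Proof. by []. Qed.

Lemma a00V_inv a : invertible (block W0 W0 a) ->
  cancel (block W0 W0 a) (a00V a) /\ cancel (a00V a) (block W0 W0 a).
Proof. by move=> [b hb]; rewrite /a00V (bop_invE hb). Qed.

(** Block elimination: the first block row of [a u] is solved for [p u], and the result is inserted
    into the second row. *)
Lemma theta_spec a u : invertible (block W0 W0 a) ->
  theta a (emb (p (a u)) + emb (q u)) = emb (p u) + emb (q (a u)).
Proof.
move=> /a00V_inv[aK Ka]; rewrite thetaE p_add q_add; congr (_ + _); congr emb.
  by rewrite p_apply raddfD /= aK addrK.
rewrite q_apply p_apply !raddfD /= aK -addrA; congr (_ + _).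
by rewrite addrC subrK.
Qed.

Lemma theta_onto a x : invertible (block W0 W0 a) ->
  exists u, x = emb (p (a u)) + emb (q u).
Proof.
move=> /a00V_inv[aK Ka].
exists (emb (a00V a (p x - block W0 W1 a (q x))) + emb (q x)).
by rewrite p_apply p_add q_add Ka subrK -decE.
Qed.

Lemma eq_wlim (U : preHilbertType R) (u v : nat -> U) (x y : U) :
  u =1 v -> x = y -> wlim u x -> wlim v y.
Proof. by move=> /funext <- <-. Qed.

Lemma rdot_proj (W : Defs.subspace H) (cW : closed_sub W) x (v : elt W) :
  rdot (orth_proj W x) v = rdot x (emb v).
Proof. by rewrite rdotC [RHS]rdotC /rdot -(projP cW). Qed.

Lemma wlim_proj (W : Defs.subspace H) (cW : closed_sub W) (u : nat -> H) x :
  wlim u x -> wlim (fun n => orth_proj W (u n)) (orth_proj W x).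
Proof.
move=> ux v; rewrite rdot_proj// [X in X @ _](_ : _ = (fun n => rdot (u n) (emb v))).
  exact: (ux (emb v)).
by apply/funext => n; rewrite rdot_proj.
Qed.

Lemma wlim_emb (W : Defs.subspace H) (cW : closed_sub W) (u : nat -> elt W) (x : elt W) :
  wlim u x -> wlim (fun n => emb (u n)) (emb x).
Proof.
have e (v : elt W) y : rdot (emb v) y = rdot v (orth_proj W y).
  by rewrite (rdotC v) rdot_proj// rdotC.
move=> ux y; rewrite e [X in X @ _](_ : _ = (fun n => rdot (u n) (orth_proj W y))).
  exact: (ux (orth_proj W y)).
by apply/funext => n; rewrite e.
Qed.

(** Each block of [theta] is isolated by applying it to a vector of [W0] or [W1] and projecting; the
    upper right one carries a minus sign. *)
Lemma schur_cvg_theta (a_ : nat -> 'Lb(H, H)) (a : schur_domain W0 W1) :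
  schur_cvg a_ a <-> (forall n, schur_domain W0 W1 (a_ n)) /\
    forall x, wlim (fun n => theta (a_ n) x) (theta (\val a) x).
Proof.
rewrite schur_cvgP; split.
  move=> [ad h1 h2 h3 h4]; split => // x; rewrite thetaE.
  under eq_fun do rewrite thetaE.
  apply: wlimD; apply: wlim_emb => //.
    by apply: wlimB; [exact: h1|exact: h2].
  by apply: wlimD; [exact: h3|exact: h4].
move=> [ad h]; split => // x.
- apply: eq_wlim (wlim_proj c0 (h (emb x))) => [n|];
    by rewrite thetaE p_add p_W0 q_W0 !linear0 addr0.
- apply: eq_wlim (wlimN (wlim_proj c0 (h (emb x)))) => [n|];
    by rewrite thetaE p_add p_W1 q_W1 !linear0 add0r opprK.
- apply: eq_wlim (wlim_proj c1 (h (emb x))) => [n|];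
    by rewrite thetaE q_add p_W0 q_W0 !linear0 !addr0.
- apply: eq_wlim (wlim_proj c1 (h (emb x))) => [n|];
    by rewrite thetaE q_add p_W1 q_W1 !linear0 add0r.
Qed.

Lemma rdot_dec x y : rdot x y = rdot (p x) (p y) + rdot (q x) (q y).
Proof. by rewrite {1}/rdot inner_dec raddfD. Qed.

Lemma nsq_dec x : nsq x = nsq (p x) + nsq (q x).
Proof. exact: rdot_dec. Qed.

Section Exchange.
Variables (a : 'Lb(H, H)) (x u : H).
Hypothesis inv : invertible (block W0 W0 a).
Hypothesis xE : x = emb (p (a u)) + emb (q u).

Lemma exchange_arg : u = emb (p (theta a x)) + emb (q x).
Proof. by rewrite xE theta_spec// p_add q_add -decE. Qed.

Lemma exchange_val : a u = emb (p x) + emb (q (theta a x)).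
Proof. by rewrite xE theta_spec// p_add q_add -decE. Qed.

(** Exchanging the [W0]-components only swaps the two factors of one summand, which leaves its real
    part unchanged. *)
Lemma exchange_rdot : rdot x (theta a x) = rdot u (a u).
Proof.
rewrite rdot_dec xE theta_spec// !p_add !q_add [RHS]rdot_dec.
by rewrite (rdotC (p (a u))).
Qed.

End Exchange.

Lemma accretive_block (alpha beta : R) a : 0 < alpha -> accretive alpha beta a ->
  invertible (block W0 W0 a).
Proof.
move=> a0 ha; apply: (closed_sub_coercive_invertible c0 a0) => x.
have [h _] := ha (emb x); apply: le_trans h _.
by rewrite /rdot /= (projP c0).
Qed.

(** Both squared norms are at most [nsq u + nsq (a u)], and accretivity bounds these summands by
    [alpha^-1] and [beta] times [rdot u (a u)]. *)
Lemma theta_coercive (alpha beta : R) a x : 0 < alpha -> 0 < beta ->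
  accretive alpha beta a ->
  nsq x <= (alpha^-1 + beta) * rdot x (theta a x) /\
  nsq (theta a x) <= (alpha^-1 + beta) * rdot x (theta a x).
Proof.
move=> a0 b0 ha; have inv := accretive_block a0 ha.
have [u xE] := theta_onto x inv; have [h1 h2] := ha u.
rewrite (exchange_rdot inv xE) xE theta_spec// !nsq_dec !p_add !q_add.
move: h1 h2; rewrite -ler_pdivlMl// ler_pdivrMl//.
rewrite (nsq_dec u) (nsq_dec (a u)) mulrDl => h1 h2.
have := nsq_ge0 (p u); have := nsq_ge0 (q u).
have := nsq_ge0 (p (a u)); have := nsq_ge0 (q (a u)).
by split; lra.
Qed.

Lemma theta_bound (alpha beta : R) a x : 0 < alpha -> 0 < beta ->
  accretive alpha beta a -> nsq (theta a x) <= (alpha^-1 + beta) ^+ 2 * nsq x.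
Proof.
move=> a0 b0 ha; have [_ h] := theta_coercive x a0 b0 ha.
have M0 : 0 < alpha^-1 + beta by rewrite addr_gt0 ?invr_gt0.
rewrite -ler_pdivrMl ?exprn_gt0// -exprVn.
(* With a constant function, the vectors [theta a x] and [x] take the roles of argument and
   value. *)
apply: (@coercive_bounded_below _ _ (fun=> x)); first by rewrite invr_ge0 ltW.
by rewrite ler_pdivrMl// rdotC.
Qed.

(** For fixed [x], both [u_ n] and [a_ n (u_ n)] are read off from [theta (a_ n) x] and converge
    weakly. Their pairing equals [rdot x (theta (a_ n) x)] and converges too, so weak lower
    semicontinuity of the norm preserves both inequalities. *)
Lemma theta_limit_accretive (alpha beta : R) (a_ : nat -> 'Lb(H, H)) a :
  0 < alpha -> 0 < beta ->
  (forall n, accretive alpha beta (a_ n)) -> invertible (block W0 W0 a) ->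
  (forall x, wlim (fun n => theta (a_ n) x) (theta a x)) -> accretive alpha beta a.
Proof.
move=> a0 b0 ha inv h u.
pose x := emb (p (a u)) + emb (q u).
have inv_ n := accretive_block a0 (ha n).
have /choice[u_ xE] : forall n, exists v, x = emb (p (a_ n v)) + emb (q v).
  by move=> n; exact: theta_onto.
have xE0 : x = emb (p (a u)) + emb (q u) by [].
have lim : (fun n => rdot (u_ n) (a_ n (u_ n))) @ \oo --> rdot u (a u).
  rewrite -(exchange_rdot inv xE0) rdotC.
  rewrite [X in X @ _](_ : _ = (fun n => rdot (theta (a_ n) x) x)); first exact: (h x x).
  by apply/funext => n; rewrite [RHS]rdotC (exchange_rdot (inv_ n) (xE n)).
have ulim : wlim u_ u.
  apply: eq_wlim (wlimD (wlim_emb c0 (wlim_proj c0 (h x))) (@wlim_cst _ _ (emb (q x)))).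
    by move=> n; exact: esym (exchange_arg (inv_ n) (xE n)).
  exact: esym (exchange_arg inv xE0).
have alim : wlim (fun n => a_ n (u_ n)) (a u).
  apply: eq_wlim (wlimD (@wlim_cst _ _ (emb (p x))) (wlim_emb c1 (wlim_proj c1 (h x)))).
    by move=> n; exact: esym (exchange_val (inv_ n) (xE n)).
  exact: esym (exchange_val inv xE0).
split.
  by apply: wlim_nsq_le ulim lim _ => [|n]; [exact: ltW|have [] := ha n (u_ n)].
by apply: wlim_nsq_le alim lim _ => [|n]; [rewrite invr_ge0 ltW|have [] := ha n (u_ n)].
Qed.

End Schur.

(** * Skew-selfadjoint operators *)

Section SkewSelfadjoint.
Context {R : realType} {H : hilbertType R}.
Variable A : operator H.
Hypothesis skA : skew_selfadjoint A.
Implicit Types (u v : elt (dom A)) (x y : H).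

Lemma skew_domain x y : (forall u, inner (A u) x = - inner (emb u) y) ->
  exists2 v, emb v = x & A v = y.
Proof.
move=> h; have : graph A (x, y) by rewrite skA.2 => u /=; rewrite h innerNr.
by move=> [v /= <- <-]; exists v.
Qed.

Lemma skew_inner u v : inner (A u) (emb v) = - inner (emb u) (A v).
Proof.
have : graph A (emb v, A v) by exists v.
by rewrite skA.2 => /(_ u) /= ->; rewrite innerNr.
Qed.

Lemma skew_rdot u v : rdot (A u) (emb v) = - rdot (emb u) (A v).
Proof. by rewrite /rdot skew_inner raddfN. Qed.

Lemma skew_rdot0 u : rdot (emb u) (A u) = 0.
Proof. have := skew_rdot u u; rewrite rdotC; lra. Qed.

Lemma skew_domain_rdot x y : (forall u, rdot (A u) x = - rdot (emb u) y) ->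
  exists2 v, emb v = x & A v = y.
Proof.
move=> h; apply: skew_domain => u; apply/eqP; rewrite eq_complex; apply/andP; split.
  by apply/eqP; rewrite -/(rdot _ _) h /rdot raddfN.
have hi : rdot ('i *: A u) x = - rdot ('i *: emb u) y by have := h ('i *: u);
  rewrite linearZ.
by move: hi; rewrite !rdotZil => /oppr_inj ->; rewrite raddfN.
Qed.

(** The identity that characterizes the graph of a skew-selfadjoint operator is preserved by weak
    limits. *)
Lemma skew_closed (u_ : nat -> elt (dom A)) x y :
  wlim (fun n => emb (u_ n)) x -> wlim (fun n => A (u_ n)) y ->
  exists2 v, emb v = x & A v = y.
Proof.
move=> ux uy; apply: skew_domain_rdot => u.
rewrite rdotC (rdotC _ y); apply: cvg_unique (ux (A u)) _ => //.
rewrite [X in X @ _](_ : _ = (fun n => - rdot (A (u_ n)) (emb u))).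
  by apply: cvgN; exact: (uy (emb u)).
by apply/funext => n; rewrite skew_rdot opprK.
Qed.

Lemma domain_dense x (e : R) : 0 < e -> exists u, nsq (x - emb u) < e.
Proof.
move=> e0; have [_ /sub_emb[u <-] h] := dense_nsq skA.1 x e0.
by exists u.
Qed.

(* Riesz representation for the functional [v |-> - inner (A v) x], extended as
   the operator [v |-> - inner (A v) x *: x]. *)
Lemma skew_domain_bounded x (C : R) : 0 <= C ->
  (forall u, rdot (A u) x ^+ 2 <= C * nsq (emb u)) -> exists v, emb v = x.
Proof.
move=> C0 xC; have [->|x0] := eqVneq x 0; first by exists 0.
pose j u := - inner (A u) x *: x.
have jl : linear j.
  by move=> k u v; rewrite /j linearP innerDl innerZl opprD scalerDl -mulrN scalerA.
pose J : {linear elt (dom A) -> H} :=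
  HB.pack j (GRing.isLinear.Build R[i] (elt (dom A)) H *:%R j jl).
have [|||S hS] := @bop_extend _ H _ _ (bemb (dom A)) J (2 * C * nsq x).
- by rewrite !mulr_ge0 ?nsq_ge0.
- move=> u; rewrite /= /j nsqZc !raddfN /= !sqrrN Im_inner.
  have := xC ('i *: u); rewrite linearZ /= nsqZi.
  have -> : rdot ('i *: A u) x ^+ 2 = rdot (A u) ('i *: x) ^+ 2.
    by rewrite -Im_inner rdotZil sqrrN.
  have := xC u; rewrite -/(rdot (A u) x); have := nsq_ge0 x; nra.
- by move=> y e /(domain_dense y).
have [z hz] := adjoint_at S x.
have k0 : inner x x != 0.
  by apply: contra_neq x0 => xx; apply: nsq_eq0; rewrite /nsq /rdot xx.
have [|v vx _] := @skew_domain x ((inner x x)^-1^* *: z); last by exists v.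
move=> u; rewrite innerZr conjCK -hz hS /= /j innerZl.
by rewrite mulrCA mulVf// mulr1 opprK.
Qed.

(** The bound on [A (u_ n)] makes [u |-> rdot (A u) x] bounded, so [x] lies in the domain; weak
    convergence is then tested on the dense domain. *)
Lemma skew_wlim (u_ : nat -> elt (dom A)) x (C : R) :
  wlim (fun n => emb (u_ n)) x -> (forall n, nsq (A (u_ n)) <= C) ->
  exists2 v, emb v = x & wlim (fun n => A (u_ n)) (A v).
Proof.
move=> ux uC; have C0 : 0 <= C by rewrite (le_trans _ (uC 0)) ?nsq_ge0.
have [|v vx] := @skew_domain_bounded x C C0.
  move=> u.
  have lim : (fun n => - rdot (A (u_ n)) (emb u)) @ \oo --> rdot (A u) x.
    rewrite rdotC [X in X @ _](_ : _ = (fun n => rdot (emb (u_ n)) (A u))).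
      exact: (ux (A u)).
    by apply/funext => n; rewrite skew_rdot opprK.
  pose f n := - rdot (A (u_ n)) (emb u).
  rewrite expr2; apply: (@ler_cvg_to _ \oo _ _ (fun n => f n * f n)
    (fun=> C * nsq (emb u))); [exact: cvgM|exact: cvg_cst|].
  near=> n; rewrite /= mulrNN -expr2 (le_trans (cauchy_schwarz _ _))//.
  by rewrite ler_wpM2r ?nsq_ge0.
exists v => //; apply: (@wlim_dense _ _ _ _ (range (@emb _ _ (dom A))) (C + nsq (A v))).
- by move=> n; rewrite (le_trans (uC n))// lerDl nsq_ge0.
- by rewrite lerDr.
- by move=> y e /(domain_dense y)[u yu]; exists (emb u) => //; exists u.
- move=> _ [u _ <-].
  rewrite skew_rdot rdotC vx.
  rewrite [X in X @ _](_ : _ = (fun n => - rdot (emb (u_ n)) (A u))).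
    by rewrite (rdotC _ x); apply: cvgN; exact: (ux (A u)).
  by apply/funext => n; rewrite skew_rdot.
Unshelve. all: by end_near. Qed.

Lemma ker_mem x : subspace_set (ker A) x -> exists2 v, emb v = x & A v = 0.
Proof. by move=> [v /= Av <-]; exists v. Qed.

Lemma mem_ker v : A v = 0 -> subspace_set (ker A) (emb v).
Proof. by move=> Av; exists v. Qed.

Lemma ker_closed : closed_sub (ker A).
Proof.
move=> z x zK zx.
have /choice[u hu] : forall n, exists u, emb u = z n /\ A u = 0.
  by move=> n; have [u ? ?] := ker_mem (zK n); exists u.
have [||v <- Av] := @skew_closed u x 0.
- by apply: eq_wlim (slim_wlim zx) => // n; have [] := hu n.
- by apply: eq_wlim (@wlim_cst _ _ 0) => // n; have [] := hu n.
exact: mem_ker.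
Qed.

Lemma ran_orth_ker u : Defs.orthogonal (ker A) (A u).
Proof.
move=> y /ker_mem[v <- Av].
by rewrite skew_inner Av inner0r oppr0.
Qed.

Lemma domain_split u : exists2 v, A v = A u & Defs.orthogonal (ker A) (emb v).
Proof.
have [y Ky hy] := projection_inner ker_closed (emb u).
have [w wy Aw] := ker_mem Ky.
exists (u - w); first by rewrite linearB /= Aw subr0.
by move=> z Kz; rewrite -(hy z Kz) -wy.
Qed.

End SkewSelfadjoint.

(** * Closed range and orthogonal decomposition from compactness *)

Section CompactResolvent.
Context {R : realType} {H : hilbertType R}.
Variable A : operator H.
Hypotheses (skA : skew_selfadjoint A) (cA : compact_embedding A).
Implicit Types (u v : elt (dom A)) (x y : H).

Definition domain_ball (B : R) : set H := [set x | exists u,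
  [/\ emb u = x, Defs.orthogonal (ker A) x & nsq x + nsq (A u) <= B]].

Lemma domain_ball_precompact B : precompact (domain_ball B).
Proof.
apply: precompact_subset (cA (sqrtC B%:C)) => x [u [ux hx uB]].
exists u => //; split; first by rewrite ux.
have s0 : 0 <= nsq x + nsq (A u) by rewrite addr_ge0 ?nsq_ge0.
rewrite /graph_norm !normE -rmorphD ler_sqrtC ?nnegrE ?lecR//; last 1 first.
- exact: le_trans uB.
- by rewrite -ux in uB.
- by rewrite -ux in s0.
Qed.

(** Otherwise there are unit vectors orthogonal to [ker A] whose images tend to zero; by compactness
    they have a limit point of norm 1 that is both in [ker A] and orthogonal to it. *)
Lemma domain_ker_gap : exists2 c : R, 0 < c &
  forall u, Defs.orthogonal (ker A) (emb u) -> c * nsq (emb u) <= nsq (A u).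
Proof.
apply: contrapT => nh.
have /choice[v hv] : forall n : nat, exists v, [/\ Defs.orthogonal (ker A) (emb v),
    nsq (emb v) = 1 & nsq (A v) <= n.+1%:R^-1].
  move=> n; apply: contrapT => nv; apply: nh.
  exists n.+1%:R^-1; [by rewrite invr_gt0|move=> u hu].
  rewrite leNgt; apply/negP => lt_u.
  have u0 : 0 < nsq (emb u).
    rewrite lt_neqAle nsq_ge0 andbT; apply/eqP => u0.
    by move: lt_u; rewrite -u0 mulr0 ltNge nsq_ge0.
  pose r := (Num.sqrt (nsq (emb u)))^-1.
  have r2 : r ^+ 2 = (nsq (emb u))^-1 by rewrite exprVn sqr_sqrtr// ltW.
  apply: nv; exists (r%:C *: u); split.
  - move=> y Ky; rewrite -[emb _]/(r%:C *: emb u) innerZl hu ?mulr0//.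
  - by rewrite -[emb _]/(r%:C *: emb u) nsqZ r2 mulVf// gt_eqF.
  - by rewrite linearZ nsqZ r2 ler_pdivrMl// mulrC ltW.
have [|phi [x [hphi phix]]] := @precompact_subseq _ _ _ (fun n => emb (v n))
  (domain_ball_precompact 2).
  move=> n; have [h1 h2 h3] := hv n; exists (v n); split => //.
  have : n.+1%:R^-1 <= 1 :> R by rewrite invf_le1// ler1n.
  by rewrite h2; move: h3; move: (n.+1%:R^-1 : R) => t; lra.
have Av : slim (fun n => A (v (phi n))) 0.
  apply: (@squeeze_cvgr _ _ _ _ (fun=> 0) harmonic).
  - near=> n; rewrite nsq_ge0/= subr0; have [_ _ h] := hv (phi n).
    by rewrite (le_trans h)// lef_pV2 ?posrE// ler_nat ltnS.
  - exact: cvg_cst.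
  - exact: cvg_harmonic.
have [w wx Aw] := skew_closed skA (slim_wlim phix) (slim_wlim Av).
have xx : nsq x = 0.
  have : inner x x = 0.
    have Kx : subspace_set (ker A) x by rewrite -wx; exact: mem_ker.
    apply: inner_eq0.
      apply: cvg_unique (slim_wlim phix (y:=x)) _ => //.
      rewrite [X in X @ _](_ : _ = fun=> 0); first exact: cvg_cst.
      by apply/funext => n; have [h _ _] := hv (phi n); rewrite /rdot h.
    apply: cvg_unique (slim_wlim phix (y:='i *: x)) _ => //.
    rewrite [X in X @ _](_ : _ = fun=> 0); first exact: cvg_cst.
    by apply/funext => n; have [h _ _] := hv (phi n); rewrite -Im_inner h.
  by rewrite /nsq /rdot => ->.
have := slim_nsq phix; rewrite xx [X in X @ _](_ : _ = fun=> 1).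
  move=> h; suff : (0 : R) = 1 by move=> /eqP; rewrite eq_sym oner_eq0.
  by apply: cvg_unique h _ => //; exact: cvg_cst.
by apply/funext => n; have [] := hv (phi n).
Unshelve. all: by end_near. Qed.

(** Preimages orthogonal to [ker A] of a convergent sequence are Cauchy by the gap, and the graph of
    [A] is closed. *)
Lemma ran_closed : closed_sub (ran A).
Proof.
move=> z x zR zx; have [c c0 hc] := domain_ker_gap.
have /choice[u hu] : forall n, exists u, A u = z n /\ Defs.orthogonal (ker A) (emb u).
  move=> n; have [u _ <-] := zR n; have [v Av hv] := domain_split skA u.
  by exists v.
have [|y uy] := @nsq_cauchy _ _ (fun n => emb (u n)).
  move=> e e0; have [N hN] := slim_cauchy zx (mulr_gt0 c0 e0).
  exists N => m n Nm Nn; rewrite -(ltr_pM2l c0).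
  apply: le_lt_trans (hN m n Nm Nn).
  have [<- om] := hu m; have [<- on] := hu n.
  rewrite -linearB -[emb _ - _]/(emb (u m - u n)) hc// => w Kw.
  by rewrite -[emb _]/(emb (u m) - emb (u n)) -scaleN1r addrC innerDl innerZl
    om// on// mulr0 addr0.
have Az : slim (fun n => A (u n)) x.
  by rewrite (_ : (fun n => _) = z)//; apply/funext => n; have [] := hu n.
have [w _ <-] := skew_closed skA (slim_wlim uy) (slim_wlim Az).
by exists w.
Qed.

(** With [z] the projection of [y] onto the range, [y - z] annihilates the range, so
    skew-selfadjointness puts it into [ker A], to which it is also orthogonal. *)
Lemma orth_ker_ran y : Defs.orthogonal (ker A) y -> subspace_set (ran A) y.
Proof.
move=> hy; have [z Rz hz] := projection_inner ran_closed y.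
have [v _ Av] : range A z by [].
suff yz : y - z = 0 by rewrite -(subrK z y) yz add0r.
apply: nsq_eq0; rewrite /nsq /rdot.
have [|w wy Aw] := @skew_domain _ _ A skA (y - z) 0.
  move=> u; rewrite inner0r oppr0 innerC hz ?rmorph0//.
  by exists u.
have K : subspace_set (ker A) (y - z) by rewrite -wy; exact: mem_ker.
suff -> : inner (y - z) (y - z) = 0 by [].
(* Only the second argument is abstracted, so that the first can still be expanded. *)
move: {1 3}(y - z) K => t Kt.
by rewrite -scaleN1r innerDl innerZl hy// -Av (ran_orth_ker skA)// mulr0 addr0.
Qed.

Lemma ker_ran_orth x y : subspace_set (ker A) x -> subspace_set (ran A) y ->
  inner x y = 0.
Proof. by move=> Kx [v _ <-]; rewrite innerC (ran_orth_ker skA) ?rmorph0. Qed.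

Lemma ker_ran_dec x : exists2 y, subspace_set (ker A) y & subspace_set (ran A) (x - y).
Proof.
have [y Ky hy] := projection_inner (ker_closed skA) x.
by exists y => //; exact: orth_ker_ran.
Qed.

End CompactResolvent.

(** * Resolvents *)

(** Additive bookkeeping for the formula [thd] in [theta_cvg_resolvent]. *)
Lemma zmod_rearrange (V : zmodType) (e s t y z w : V) :
  - e + (s + (w - y)) = s - t - (y - z) + (t + (w - z) - e).
Proof.
rewrite opprB [RHS]addrA [LHS]addrC; congr (_ + _).
by rewrite (addrACA (s - t)) subrK; congr (_ + _); rewrite [RHS]addrC [RHS]addrA subrK.
Qed.

Section Resolvent.
Context {R : realType} {H : hilbertType R}.
Variables (A : operator H) (alpha beta : R).
Hypotheses (skA : skew_selfadjoint A) (a0 : 0 < alpha) (b0 : 0 < beta).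
Implicit Types (u v : elt (dom A)) (x y f : H) (T S : 'Lb(H, H)).

Lemma op_add_rdot T u : rdot (emb u) (op_add T A u) = rdot (emb u) (T (emb u)).
Proof. by rewrite /= /op_add_fun rdotDr skew_rdot0// addr0. Qed.

(** By skewness [A] adds nothing to the real part, so [op_add T A] is bounded below. A vector [z]
    orthogonal to its range lies in [dom A] with [A z = T^* z], so [rdot z (T z) = rdot z (A z) = 0]
    and [z = 0]. *)
Lemma op_add_inverse T : accretive alpha beta T ->
  exists S, is_op_inverse (op_add T A) S.
Proof.
move=> hT; pose L := op_add T A.
have below (u : elt (dom A)) : alpha ^+ 2 * nsq (emb u) <= nsq (L u).
  apply: (@coercive_bounded_below _ _ (fun=> L u)); first exact: ltW.
  by rewrite op_add_rdot; have [] := hT (emb u).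
have a2 : 0 < alpha ^+ 2 by rewrite exprn_gt0.
have onto y : exists u, L u = y.
  apply: (@closed_range _ _ _ full_sub L _ a2) => //.
    move=> u x z ux Lz; have Tx := bop_slim T ux.
    have Az : wlim (fun n => A (u n)) (z - T x).
      apply: eq_wlim (wlimB (slim_wlim Lz) (slim_wlim Tx)) => // n.
      by rewrite /= /op_add_fun addrC addKr.
    have [v vx Av] := skew_closed skA (slim_wlim ux) Az.
    by exists v => //; rewrite /= /op_add_fun vx Av addrC subrK.
  move=> z _ hz; have [t ht] := adjoint_at T z.
  have [|v vz Av] := @skew_domain _ _ _ skA z t.
    move=> u; have := hz u; rewrite /= /op_add_fun innerC => /eqP.
    rewrite conjC_eq0 innerDl ht addrC addr_eq0 => /eqP //.
  apply: nsq_eq0; apply/eqP; rewrite eq_le nsq_ge0 andbT.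
  rewrite -(pmulr_rle0 _ a0); have [h _] := hT z; apply: le_trans h _.
  by rewrite rdotC /rdot ht -vz -Av -/(rdot _ _) skew_rdot0.
have [|S hS] := @bop_factor _ _ _ _ L (bemb (dom A)) (alpha ^+ 2)^-1 _ onto.
  by move=> u; rewrite ler_pdivlMl//; exact: below.
exists S; split; first by move=> u; rewrite hS.
by move=> y; have [u <-] := onto y; exists u => //; rewrite hS.
Qed.

Lemma op_add_invP T : accretive alpha beta T ->
  is_op_inverse (op_add T A) (op_inv (op_add T A)).
Proof. by move=> /op_add_inverse[S hS]; rewrite (op_invE hS). Qed.

Lemma op_add_inv_dom T f : accretive alpha beta T ->
  exists u, emb u = op_inv (op_add T A) f /\ T (emb u) + A u = f.
Proof. by move=> /op_add_invP[_ /(_ f)[u uS uf]]; exists u. Qed.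

Lemma resolvent_bound : exists2 C : R, 0 <= C &
  forall T u f, accretive alpha beta T -> T (emb u) + A u = f ->
    nsq (emb u) <= C * nsq f /\ nsq (A u) <= C * nsq f.
Proof.
pose K := (alpha ^+ 2)^-1.
have K0 : 0 < K by rewrite invr_gt0 exprn_gt0.
(* [K] bounds [u]; the rest bounds [A u = f - T u], where [nsq (T u) <= beta ^+ 2 * nsq u]. *)
exists (K + 2 + 2 * beta ^+ 2 * K).
  have p0 : 0 <= beta ^+ 2 * K by rewrite mulr_ge0 ?sqr_ge0 ?ltW.
  by rewrite -mulrA; lra.
move=> T u f hT uf; have [h1 h2] := hT (emb u).
have ub : nsq (emb u) <= K * nsq f.
  rewrite ler_pdivlMl ?exprn_gt0//.
  apply: (@coercive_bounded_below _ _ (fun=> f)); first exact: ltW.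
  by rewrite -uf -[_ + _]/(op_add T A u) op_add_rdot.
have Tb : nsq (T (emb u)) <= beta ^+ 2 * nsq (emb u).
  rewrite -ler_pdivrMl ?exprn_gt0// -exprVn.
  apply: (@coercive_bounded_below _ _ (fun=> emb u)); first by rewrite invr_ge0 ltW.
  by rewrite (rdotC (T _)).
have Ab : nsq (A u) <= 2 * nsq f + 2 * nsq (T (emb u)).
  by rewrite -uf -{1}(addKr (T (emb u)) (A u)) addrC nsqB_le.
have b2 := sqr_ge0 beta; have f0 := nsq_ge0 f.
have p1 : 0 <= K * nsq f by rewrite (mulr_ge0 (ltW K0)).
have p2 : 0 <= beta ^+ 2 * (K * nsq f) by rewrite mulr_ge0.
have p3 : beta ^+ 2 * nsq (emb u) <= beta ^+ 2 * (K * nsq f) by rewrite ler_wpM2l.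
by split; rewrite !mulrDl -?mulrA; lra.
Qed.

End Resolvent.

(** * From Schur convergence to convergence of resolvents *)

Section Equivalence.
Context {R : realType} {H : hilbertType R}.
Variables (A : operator H) (alpha beta : R).
Hypotheses (skA : skew_selfadjoint A) (cA : compact_embedding A).
Hypotheses (a0 : 0 < alpha) (b0 : 0 < beta).
Implicit Types (u v : elt (dom A)) (x y f : H) (T S : 'Lb(H, H)).

Let c0 := ker_closed skA.
Let c1 := ran_closed skA cA.
Let orth := @ker_ran_orth _ _ _ skA.
Let dec := ker_ran_dec skA cA.
Let p := orth_proj (ker A).
Let q := orth_proj (ran A).
Let th := theta (ker A) (ran A).

Lemma ker_part_dom x : exists2 w : elt (dom A), emb w = emb (p x) & A w = 0.
Proof. by apply: ker_mem; exact: emb_sub. Qed.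

Lemma p_ran u : p (A u) = 0.
Proof. by apply: proj_orth => //; exact: ran_orth_ker. Qed.

Lemma q_ran u : emb (q (A u)) = A u.
Proof. by apply: proj_id => //; exists u. Qed.

Lemma ran_part_dom u : exists2 v, emb v = emb (q (emb u)) & A v = A u.
Proof.
have [w wp Aw] := ker_part_dom (emb u); exists (u - w).
  rewrite -[LHS]/(emb u - emb w) wp {1}(decE c0 c1 orth dec (emb u)).
  by rewrite addrC addKr.
by rewrite linearB /= Aw subr0.
Qed.

Lemma resolvent_exchange T u f : T (emb u) + A u = f ->
  emb (p f) + emb (q (emb u)) = emb (p (T (emb u))) + emb (q (emb u)).
Proof. by move=> <-; rewrite linearD /= p_ran addr0. Qed.

(** As [A u] lies in the range of [A], the equation splits into [p f = p (T u)] and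
    [q (T u) = q f - A u]. *)
Lemma theta_resolvent T u f : accretive alpha beta T -> T (emb u) + A u = f ->
  th T (emb (p f) + emb (q (emb u))) = emb (p (emb u)) + (emb (q f) - A u).
Proof.
move=> hT uf; rewrite (resolvent_exchange uf) /th theta_spec//; last first.
  exact: accretive_block hT.
have -> : emb (q f) = emb (q (T (emb u))) + emb (q (A u)) by rewrite -uf linearD.
by rewrite q_ran addrK.
Qed.

(** The range component of [u] differs from [u] by a kernel vector: it stays in the domain with the
    same image under [A] and no larger norm. *)
Lemma ran_part_precompact (B : R) : exists2 P : set H, precompact P &
  forall u, nsq (emb u) <= B -> nsq (A u) <= B -> P (emb (q (emb u))).
Proof.
exists (domain_ball A (B + B)); first exact: domain_ball_precompact.
move=> u uB AB; have [v vq Av] := ran_part_dom u; exists v; split => //.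
  move=> y Ky; have [w _ <-] := emb_sub (q (emb u)).
  exact: ran_orth_ker.
rewrite Av lerD// (le_trans _ uB)// [leRHS](nsq_dec c0 c1 orth dec).
by rewrite lerDr nsq_ge0.
Qed.

Lemma theta_cvg_resolvent (T_ : nat -> 'Lb(H, H)) T :
  (forall n, accretive alpha beta (T_ n)) -> accretive alpha beta T ->
  (forall x, wlim (fun n => th (T_ n) x) (th T x)) ->
  forall f, wlim (fun n => op_inv (op_add (T_ n) A) f) (op_inv (op_add T A) f).
Proof.
move=> hT_ hT h f; have [C C0 bound] := resolvent_bound skA a0 b0.
have [u [uS uf]] := op_add_inv_dom skA a0 f hT.
have /choice[u_ hu_] : forall n, exists v,
    emb v = op_inv (op_add (T_ n) A) f /\ T_ n (emb v) + A v = f.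
  by move=> n; exact: op_add_inv_dom (hT_ n).
have uf_ n := (hu_ n).2; have uS_ n := (hu_ n).1.
pose M := alpha^-1 + beta.
have M0 : 0 < M by rewrite addr_gt0 ?invr_gt0.
pose d n := emb (q (emb (u_ n - u))).
have dE n : d n = emb (q (emb (u_ n))) - emb (q (emb u)).
  by rewrite /d !(embB, bopB).
pose x := emb (p f) + emb (q (emb u)).
pose r n := th T x - th (T_ n) x.
have r0 : wlim r 0.
  apply: eq_wlim (wlimB (@wlim_cst _ _ (th T x)) (h x)) => //; exact: subrr.
have thx : th T x = emb (p (emb u)) + (emb (q f) - A u) by exact: theta_resolvent.
have xnE n : emb (p f) + emb (q (emb (u_ n))) = x + d n.
  by rewrite dE /x -addrA [_ + (_ - _)]addrC subrK.
(* The first two summands have real inner product [0] with [d n]: one lies in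
   [ker A], and [A] is skew. *)
have thd n : th (T_ n) (d n) = emb (p (emb (u_ n - u))) - A (u_ n - u) + r n.
  have := theta_resolvent (hT_ n) (uf_ n); rewrite xnE bopD => /(canRL (addKr _)) ->.
  rewrite /r thx !(embB, bopB) linearB.
  exact: zmod_rearrange.
have rd n : rdot (d n) (th (T_ n) (d n)) = rdot (d n) (r n).
  rewrite thd rdotDr rdotBr.
  have -> : rdot (d n) (emb (p (emb (u_ n - u)))) = 0.
    by rewrite rdotC /rdot orth//; exact: emb_sub.
  have [v vq vA] := ran_part_dom (u_ n - u).
  by rewrite /d -vq -vA skew_rdot0// subr0 add0r.
(* The factor 4 comes from [nsqB_le] applied to a difference of two vectors with the same bound. *)
have [P cP hP] := ran_part_precompact (4 * (C * nsq f)).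
have Pd n : P (d n).
  have [ub Ab] := bound _ _ _ hT uf; have [unb Anb] := bound _ _ _ (hT_ n) (uf_ n).
  apply: hP; rewrite ?(embB, linearB); apply: le_trans (nsqB_le _ _) _; lra.
have rb n : nsq (r n) <= 4 * (M ^+ 2 * nsq x).
  have := theta_bound c0 c1 orth dec x a0 b0 hT.
  have := theta_bound c0 c1 orth dec x a0 b0 (hT_ n).
  rewrite -/M -/th => h1 h2; have := nsqB_le (th T x) (th (T_ n) x); rewrite -/(r n).
  move: (M ^+ 2 * nsq x) h1 h2 => t; lra.
have d0 : slim d 0.
  apply: (@squeeze_cvgr _ _ _ _ (fun=> 0) (fun n => M * rdot (d n) (r n))).
  - near=> n; rewrite nsq_ge0 /= subr0 -rd.
    by have [] := theta_coercive c0 c1 orth dec (d n) a0 b0 (hT_ n).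
  - exact: cvg_cst.
  - by rewrite -(mulr0 M); apply: cvgMr; exact: (precompact_rdot cP Pd rb r0).
have thd0 : slim (fun n => th (T_ n) (d n)) 0.
  apply: (slim_le d0 (sqr_ge0 M)) => n; rewrite !subr0.
  exact: theta_bound.
(* This vector is [theta] at the exchange argument of the [n]-th solution; its kernel component is
   that of [u_ n]. *)
have thxn : wlim (fun n => th (T_ n) (x + d n)) (th T x).
  apply: eq_wlim (wlimD (h x) (slim_wlim thd0)) => [n|]; last by rewrite addr0.
  by rewrite bopD.
rewrite -uS; apply: eq_wlim (wlimD (wlim_emb c0 (wlim_proj c0 thxn))
  (wlimD (@wlim_cst _ _ (emb (q (emb u)))) (slim_wlim d0))) => [n|]; last first.
  rewrite addr0 thx [RHS](decE c0 c1 orth dec) -/p -/q; congr (emb _ + _).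
  by rewrite bopD bopB p_ran (p_W0 c0) (p_W1 c0 orth) subr0 addr0.
rewrite -uS_ -xnE (theta_resolvent (hT_ n) (uf_ n)).
rewrite [RHS](decE c0 c1 orth dec) -/p -/q dE (addrC (emb (q (emb u)))) subrK.
congr (emb _ + _).
by rewrite bopD bopB p_ran (p_W0 c0) (p_W1 c0 orth) subr0 addr0.
Unshelve. all: by end_near. Qed.

End Equivalence.

(** * From convergence of resolvents to Schur convergence *)

Section DenseConvergence.
Context {R : realType} {U V : preHilbertType R}.

(** The uniform bound makes the error from replacing [x] by [z] in [D] less than [e / 3], for all
    [a_ n] and for [a]. *)
Lemma bop_wlim_dense (a_ : nat -> 'Lb(U, V)) (a : 'Lb(U, V)) (D : set U) (C : R) :
  0 <= C -> (forall n x, nsq (a_ n x) <= C * nsq x) -> (forall x, nsq (a x) <=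
    C * nsq x) ->
  (forall x (e : R), 0 < e -> exists2 z, D z & nsq (x - z) < e) ->
  (forall z, D z -> wlim (fun n => a_ n z) (a z)) ->
  forall x, wlim (fun n => a_ n x) (a x).
Proof.
move=> C0 aC_ aC dD h x y; apply/cvgrPdist_lt => e e0.
have K0 : 0 < 36 * (C + 1) * (nsq y + 1).
  by rewrite !mulr_gt0// ltr_wpDl ?nsq_ge0.
have [|z Dz zx] := dD x (e ^+ 2 / (36 * (C + 1) * (nsq y + 1))).
  by rewrite divr_gt0 ?exprn_gt0.
have hv (b : 'Lb(U, V)) : (forall x, nsq (b x) <= C * nsq x) -> `|rdot (b (x -
  z)) y| < e / 3.
  move=> bC; rewrite normr_lt_sqr ?divr_gt0// (le_lt_trans (cauchy_schwarz _ _))//.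
  have b0 := nsq_ge0 (b (x - z)); have y0 := nsq_ge0 y.
  move: zx (bC (x - z)) (nsq_ge0 (x - z)); rewrite ltr_pdivlMr//.
  move: (nsq (x - z)) (nsq (b (x - z))) (nsq y) b0 y0 => s t r t0 r0 h1 h2 s0.
  have h3 : t * r <= (C + 1) * s * (r + 1).
    apply: ler_pM => //; last by rewrite lerDl.
    by apply: le_trans h2 _; rewrite ler_wpM2r// lerDl.
  have h4 : (C + 1) * s * (r + 1) * 36 < e ^+ 2.
    by rewrite (_ : _ * 36 = s * (36 * (C + 1) * (r + 1))) //; ring.
  have -> : (e / 3) ^+ 2 = e ^+ 2 / 9 by field.
  have : 0 <= t * r by rewrite mulr_ge0.
  lra.
near=> n.
have h1 : `|rdot (a z) y - rdot (a_ n z) y| < e / 3.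
  by near: n; have /cvgrPdist_lt := h z Dz y; apply; rewrite divr_gt0.
have -> : rdot (a x) y - rdot (a_ n x) y =
  rdot (a (x - z)) y - rdot (a_ n (x - z)) y + (rdot (a z) y - rdot (a_ n z) y).
  by rewrite !bopB !rdotBl; ring.
have := hv _ (aC_ n); have := hv _ aC; move: h1.
rewrite !ltr_norml => /andP[? ?] /andP[? ?] /andP[? ?]; apply/andP; split; lra.
Unshelve. all: by end_near. Qed.

End DenseConvergence.

Section Converse.
Context {R : realType} {H : hilbertType R}.
Variables (A : operator H) (alpha beta : R).
Hypotheses (skA : skew_selfadjoint A) (cA : compact_embedding A).
Hypotheses (a0 : 0 < alpha) (b0 : 0 < beta).
Implicit Types (u v : elt (dom A)) (x y f : H) (T S : 'Lb(H, H)).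

Let c0 := ker_closed skA.
Let c1 := ran_closed skA cA.
Let orth := @ker_ran_orth _ _ _ skA.
Let dec := ker_ran_dec skA cA.
Let p := orth_proj (ker A).
Let q := orth_proj (ran A).
Let th := theta (ker A) (ran A).

Lemma resolvent_limit_dom (T_ : nat -> 'Lb(H, H)) S f :
  (forall n, accretive alpha beta (T_ n)) ->
  wlim (fun n => op_inv (op_add (T_ n) A) f) (S f) ->
  exists (u_ : nat -> elt (dom A)) v, [/\
    forall n, emb (u_ n) = op_inv (op_add (T_ n) A) f,
    forall n, T_ n (emb (u_ n)) + A (u_ n) = f,
    emb v = S f & wlim (fun n => A (u_ n)) (A v)].
Proof.
move=> hT_ hS; have [C C0 bound] := resolvent_bound skA a0 b0.
have /choice[u_ hu_] : forall n, exists v,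
    emb v = op_inv (op_add (T_ n) A) f /\ T_ n (emb v) + A v = f.
  by move=> n; exact: op_add_inv_dom (hT_ n).
have [||v vS Av] := @skew_wlim _ _ _ skA u_ (S f) (C * nsq f).
- by apply: eq_wlim hS => // n; rewrite (hu_ n).1.
- by move=> n; have [] := bound _ _ _ (hT_ n) (hu_ n).2.
by exists u_, v; split => // n; have [] := hu_ n.
Qed.

Lemma resolvent_cvg_theta (T_ : nat -> 'Lb(H, H)) T :
  (forall n, accretive alpha beta (T_ n)) -> accretive alpha beta T ->
  (forall f, wlim (fun n => op_inv (op_add (T_ n) A) f) (op_inv (op_add T A) f)) ->
  forall x, wlim (fun n => th (T_ n) x) (th T x).
Proof.
move=> hT_ hT h; have [C C0 bound] := resolvent_bound skA a0 b0.
pose M := alpha^-1 + beta.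
have M0 : 0 < M by rewrite addr_gt0 ?invr_gt0.
apply: (@bop_wlim_dense _ _ _ _ _ [set x | exists v f,
  T (emb v) + A v = f /\ x = emb (p f) + emb (q (emb v))] (M ^+ 2)).
- exact: sqr_ge0.
- by move=> n x; exact: theta_bound.
- by move=> x; exact: theta_bound.
(* Write [x] as the exchange argument of some [y], approximate [y] by [v] in the domain, and take
   [f = T v + A v]; the term [A v] has no kernel component. *)
- move=> x e e0; have [y xE] := theta_onto c0 c1 orth dec x (accretive_block c0 a0 hT).
  have [B B0 TB] := bop_nsq T.
  have B1 : 0 < B + 1 by rewrite ltr_wpDl.
  have [v yv] := domain_dense skA y (divr_gt0 e0 B1).
  exists (emb (p (T (emb v) + A v)) + emb (q (emb v))); first by exists v, (T
    (emb v) + A v).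
  rewrite bopD (p_ran skA) addr0 xE opprD addrACA.
  rewrite -/p -/q -!embB -!bopB [ltLHS](nsq_dec c0 c1 orth dec).
  rewrite p_add// q_add//.
  move: yv; rewrite ltr_pdivlMr// => yv; apply: le_lt_trans yv.
  have h1 : nsq (p (T (y - emb v))) <= nsq (T (y - emb v)).
    by rewrite [leRHS](nsq_dec c0 c1 orth dec) lerDl nsq_ge0.
  have h2 : nsq (q (y - emb v)) <= nsq (y - emb v).
    by rewrite [leRHS](nsq_dec c0 c1 orth dec) lerDr nsq_ge0.
  have := TB (y - emb v); lra.
move=> _ [u [f [uf ->]]].
have [u_ [v [uS_ uf_ vS Av]]] := resolvent_limit_dom hT_ (h f).
have uv : u = v.
  apply: val_inj; rewrite /= vS; have [h1 _] := op_add_invP skA a0 hT.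
  by rewrite -uf -[_ + _]/(op_add T A u) h1.
subst v.
have ulim : wlim (fun n => emb (u_ n)) (emb u).
  by apply: eq_wlim (h f) => // n; rewrite uS_.
pose d n := emb (q (emb (u_ n))) - emb (q (emb u)).
have dlim : wlim d 0.
  have /wlim_sub0 := wlim_emb c1 (wlim_proj c1 ulim); exact.
have [P cP hP] := ran_part_precompact skA cA (4 * (C * nsq f)).
have Pd n : P (d n).
  have [ub Ab] := bound _ _ _ hT uf; have [unb Anb] := bound _ _ _ (hT_ n) (uf_ n).
  rewrite /d -embB -bopB -embB.
  apply: hP; rewrite ?(embB, linearB); apply: le_trans (nsqB_le _ _) _; lra.
(* Here [d] is paired with itself: it is weakly null and stays in a precompact set. *)
have d0 : slim d 0.
  rewrite /slim; under eq_fun do rewrite subr0.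
  apply: (precompact_rdot cP Pd (C := 4 * (C * nsq f)) _ dlim) => n.
  have [ub Ab] := bound _ _ _ hT uf; have [unb Anb] := bound _ _ _ (hT_ n) (uf_ n).
  have h2 : nsq (d n) <= nsq (emb (u_ n) - emb u).
    by rewrite [leRHS](nsq_dec c0 c1 orth dec) /d -embB -bopB lerDr nsq_ge0.
  have := nsqB_le (emb (u_ n)) (emb u); lra.
have thd0 : slim (fun n => th (T_ n) (d n)) 0.
  apply: (slim_le d0 (sqr_ge0 M)) => n; rewrite !subr0.
  exact: theta_bound.
have lim : wlim (fun n => emb (p (emb (u_ n))) + (emb (q f) - A (u_ n)) - th (T_ n) (d n))
    (emb (p (emb u)) + (emb (q f) - A u) - 0).
  apply: wlimB (slim_wlim thd0).
  apply: wlimD (wlim_emb c0 (wlim_proj c0 ulim)) _.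
  by apply: wlimB Av; exact: wlim_cst.
apply: eq_wlim lim => [n|]; last by rewrite subr0 (theta_resolvent skA cA a0 hT uf).
rewrite -(theta_resolvent skA cA a0 (hT_ n) (uf_ n)) -bopB /d.
by congr (th _ _); rewrite opprB -addrA [X in _ + X]addrC subrK.
Qed.

Lemma resolvent_limit (T_ : nat -> 'Lb(H, H)) S :
  (forall n, accretive alpha beta (T_ n)) ->
  (forall f, wlim (fun n => op_inv (op_add (T_ n) A) f) (S f)) ->
  exists2 T : 'Lb(H, H), accretive alpha beta T & S = op_inv (op_add T A).
Proof.
move=> hT_ hS.
(* Since [f] is fixed, [rdot (u_ n) f] converges, while [T_ n (u_ n) = f - A (u_ n)] converges
   weakly; both accretivity inequalities pass to the limit. *)
have /choice[v hv] : forall f, exists v, [/\ emb v = S f,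
    alpha * nsq (S f) <= rdot (S f) f & beta^-1 * nsq (f - A v) <= rdot (S f) f].
  move=> f; have [u_ [v [uS_ uf_ vS Av]]] := resolvent_limit_dom hT_ (hS f).
  have ulim : wlim (fun n => emb (u_ n)) (S f) by apply: eq_wlim (hS f) => //
    n; rewrite uS_.
  have uT n : rdot (emb (u_ n)) f = rdot (emb (u_ n)) (T_ n (emb (u_ n))).
    by rewrite -op_add_rdot// -{1}(uf_ n).
  exists v; split => //.
    apply: (wlim_nsq_le _ ulim (ulim f)) => [|n]; first exact: ltW.
    by rewrite uT; have [] := hT_ n (emb (u_ n)).
  apply: (wlim_nsq_le _ (wlimB (@wlim_cst _ _ f) Av) (ulim f)).
    by rewrite invr_ge0 ltW.
  move=> n; rewrite uT -{1}(uf_ n) addrK.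
  by have [] := hT_ n (emb (u_ n)).
have vS f : emb (v f) = S f by have [] := hv f.
(* The value that the operator [T] to be constructed must take at [S f]. *)
pose J f := f - A (v f).
have Jl : linear J.
  move=> k f g; have -> : J (k *: f + g) = k *: f + g - A (k *: v f + v g).
    rewrite /J; congr (_ - A _); apply: val_inj.
    by rewrite /= vS bop_linear -!vS.
  by rewrite linearP /J scalerBr opprD addrACA.
pose JL : {linear H -> H} := HB.pack J (GRing.isLinear.Build R[i] H H *:%R J Jl).
have SJ f : rdot (S f) f = rdot (S f) (J f).
  by rewrite /J rdotBr -vS skew_rdot0// subr0.
have h1 f : alpha * nsq (S f) <= rdot (S f) (J f) by rewrite -SJ; have [] := hv f.
have h2 f : beta^-1 * nsq (J f) <= rdot (S f) (J f) by rewrite -SJ; have [] := hv f.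
(* If [f] is orthogonal to the range of [S], the first inequality gives [S f = 0], and the second
   then gives [f = 0]. *)
have dS : forall y (e : R), 0 < e -> exists f, nsq (y - S f) < e.
  apply: trivial_orth_dense => f hf.
  have z : rdot (S f) f = 0 by rewrite rdotC /rdot hf.
  have Sf : S f = 0.
    apply: nsq_eq0; apply/eqP; rewrite eq_le nsq_ge0 andbT -(pmulr_rle0 _ a0).
    by rewrite -z SJ.
  have vf : v f = 0 by apply: val_inj; rewrite /= vS Sf.
  apply: nsq_eq0; apply/eqP; rewrite eq_le nsq_ge0 andbT.
  have := h2 f; rewrite -SJ z /J vf linear0 subr0 pmulr_rle0 ?invr_gt0//.
have [|T hT] := @bop_extend _ H _ _ S JL (beta ^+ 2) (sqr_ge0 beta) _ dS.
  move=> f; rewrite -ler_pdivrMl ?exprn_gt0// -exprVn.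
  apply: (@coercive_bounded_below _ _ (fun=> S f)); first by rewrite invr_ge0 ltW.
  by rewrite (rdotC _ (S f)); exact: h2.
have TS f : T (S f) = J f by exact: hT.
have accT : accretive alpha beta T.
  move=> y.
  have /choice[f hf] : forall n : nat, exists f, nsq (y - S f) < n.+1%:R^-1.
    by move=> n; apply: dS; rewrite invr_gt0.
  have Sy : slim (fun n => S (f n)) y.
    apply: (@squeeze_cvgr _ _ _ _ (fun=> 0) harmonic).
    - by near=> n; rewrite nsq_ge0/= nsqBC ltW.
    - exact: cvg_cst.
    - exact: cvg_harmonic.
  have Ty := bop_slim T Sy; have lim := slim_rdot Sy Ty.
  split.
    apply: (wlim_nsq_le _ (slim_wlim Sy) lim); first exact: ltW.
    by move=> n; rewrite TS; exact: h1.
  apply: (wlim_nsq_le _ (slim_wlim Ty) lim); first by rewrite invr_ge0 ltW.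
  by move=> n; rewrite TS; exact: h2.
exists T => //; apply: val_inj; apply/funext => f.
have [hinv _] := op_add_invP skA a0 accT.
have := hinv (v f).
by rewrite /= /op_add_fun vS TS /J subrK.
Unshelve. all: by end_near. Qed.

End Converse.

Theorem theorem3p2p3 (R : realType) (H : hilbertType R) (alpha beta : R)
    (A : operator H) (T_ : nat -> 'Lb(H, H)) :
  separable H ->
  0 < alpha -> alpha <= beta ->
  skew_selfadjoint A ->
  compact_embedding A ->
  (forall n, classF alpha beta (T_ n)) ->
  ((exists T : schur_domain (ker A) (ran A), schur_cvg T_ T) <->
   (exists S : 'Lb(H, H), wot_cvg (fun n => op_inv (op_add (T_ n) A)) S)) /\
  (forall (T : schur_domain (ker A) (ran A)) (S : 'Lb(H, H)),
     schur_cvg T_ T ->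
     wot_cvg (fun n => op_inv (op_add (T_ n) A)) S ->
     classF alpha beta (\val T) /\ S = op_inv (op_add (\val T) A)).
Proof.
move=> _ a0 ab skA cA hF.
have b0 : 0 < beta by exact: lt_le_trans ab.
have hT_ n : accretive alpha beta (T_ n) by apply/classF_accretive.
have c0 := ker_closed skA; have c1 := ran_closed skA cA.
have orth := @ker_ran_orth _ _ _ skA; have dec := ker_ran_dec skA cA.
(* Besides one implication, this identifies the limit of the resolvents, so the final claim reduces
   to uniqueness of weak limits. *)
have direct (T : schur_domain (ker A) (ran A)) : schur_cvg T_ T ->
    accretive alpha beta (\val T) /\
    wot_cvg (fun n => op_inv (op_add (T_ n) A)) (op_inv (op_add (\val T) A)).
  move=> /(schur_cvg_theta c0 c1 orth)[_ h].
  have [_ inv] := set_valP T.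
  have hT := theta_limit_accretive c0 c1 orth dec a0 b0 hT_ inv h.
  by split => //; apply/wot_cvgP; exact: (theta_cvg_resolvent skA cA a0 b0 hT_ hT h).
split; [split|].
- by move=> [T /direct[_ h]]; eexists; exact: h.
- move=> [S /wot_cvgP hS]; have [T hT ST] := resolvent_limit skA a0 b0 hT_ hS.
  rewrite ST in hS.
  have inv : schur_domain (ker A) (ran A) T.
    split; last exact: accretive_block hT.
    by apply: (coercive_invertible a0) => x; have [] := hT x.
  exists (SigSub (mem_set inv)); apply/(schur_cvg_theta c0 c1 orth); split.
    move=> n; split; first by have [_ []] := hF n.
    exact: accretive_block (hT_ n).
  exact: (resolvent_cvg_theta skA cA a0 b0 hT_ hT hS).
- move=> T S /direct[hT hinv] hS; split; first exact/classF_accretive.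
  apply: val_inj; apply/funext => f.
  move: hS hinv => /wot_cvgP/(_ f) h1 /wot_cvgP/(_ f) h2.
  exact: wlim_unique h1 h2.
Qed.
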